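(* Let $(G_N)_{N\in\mathbb N}$ be an increasing sequence of compact groups of $*$-automorphisms of a $C^*$-algebra $\mathcal A$, let $G=\bigcup_N G_N$ (a separable locally compact group), and let $\varphi$ be a faithful $G$-strongly quasi-invariant state on $\mathcal A$, with GNS representation $(\mathcal H,\pi,\Phi)$ and $\mathfrak A=\pi(\mathcal A)''$. Let $P_N=\int_{G_N}U_g\,dg$, $P_G=\text{s-}\lim_N P_N$, $\Phi_G=P_G\Phi$, $K_N=\int_{G_N}\pi(x_g^{1/2})\,dg$, and $E_N(x)=\int_{G_N}u_g(x)\,dg$ for $x\in\mathfrak A$. Suppose that at least one of the following holds: (a) $\Phi_G\neq 0$ and the state $\psi_G(\cdot)=\|\Phi_G\|^{-2}\langle\Phi_G,\,\cdot\,\Phi_G\rangle$ on $\mathfrak A$ is faithful; or (b) the sequence $(K_N)_N$ converges weakly to an invertible operator $K_G$. Then for any $x\in\mathfrak A$ the sequence $(x_N)_N$ with $x_N:=E_N(x)$ is a (decreasing) martingale, and hence has a strong limit. Furthermore, defining $E_\infty(x):=\lim_N E_N(x)$ (strong limit), $E_\infty$ is an Umegaki conditional expectation from $(\mathfrak A,\psi_G)$ onto $\mathrm{Fix}(u_G):=\{x\in\mathfrak A:u_g(x)=x\ \ \forall g\in G\}$.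
   Context: A faithful state $\varphi$ on $\mathcal A$ is $G$-strongly quasi-invariant if for every $g\in G$ there is a self-adjoint $x_g\in\mathcal A$ with $\varphi(g(a))=\varphi(x_g a)$ for all $a\in\mathcal A$. (It is known that then each $x_g$ is strictly positive, lies in the centralizer of $\varphi$, and the $x_g$ commute with each other.) The formula $U_g\pi(a)\Phi=\pi(g(a)x_{g^{-1}}^{1/2})\Phi$ $(a\in\mathcal A)$ defines a unitary representation $g\mapsto U_g$ of $G$ on $\mathcal H$. On $\mathfrak A$ put $u_g(x)=U_g x U_g^*$; these are $*$-automorphisms of $\mathfrak A$ with $u_g(\pi(a))=\pi(g(a))$. Standing assumptions: on each $G_N$ the map $g\mapsto x_g\in\mathcal A$ is continuous and $g\mapsto U_g$ is strongly continuous. Integrals over $G_N$ are with respect to normalized Haar measure. The $P_N$ form a decreasing sequence of orthogonal projections, so the strong limit $P_G$ exists; one has $P_N\Phi=K_N\Phi$, so $\Phi_G=\lim_N K_N\Phi$. Decreasing martingale: with $\mathfrak B_N:=\mathrm{Fix}(u_{G_N})=\{x\in\mathfrak A:u_g(x)=x\ \forall g\in G_N\}$ (a decreasing sequence of von Neumann subalgebras), a sequence $(x_N)_N$ in $\mathfrak A$ with $x_N\in\mathfrak B_N$ and $E_N(x_M)=x_N$ for all $M\le N$. Umegaki conditional expectation $E:(\mathfrak A,\psi)\to\mathfrak B$ onto a von Neumann subalgebra $\mathfrak B$: a normal, contractive, positive projection of $\mathfrak A$ onto $\mathfrak B$ such that (i) $E(yxy')=yE(x)y'$ for all $x\in\mathfrak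 A$, $y,y'\in\mathfrak B$, and (ii) $\psi\circ E=\psi$.
   Formalization: In alternative (b) it is additionally assumed that the vector state of Φ (the normal extension of φ) is faithful on 𝔄=π(𝒜)'', i.e. Φ is separating for 𝔄; with φ faithful only on 𝒜, (b) fails, as the averages E_N(x) need not converge strongly. *)

(* Defs.v *)
From HB Require Import structures.
From mathcomp Require Import all_boot all_order all_algebra.
From mathcomp Require Import complex.
From mathcomp Require Import all_classical all_reals all_analysis.
Set Implicit Arguments.
Unset Strict Implicit.
Unset Printing Implicit Defensive.
Import Order.TTheory GRing.Theory Num.Theory.
Import numFieldNormedType.Exports.
Local Open Scope classical_set_scope.
Local Open Scope ring_scope.
Local Open Scope complex_scope.

(* Complex C*-algebras, not assumed to have a unit; norms are values in [R[i]],
   as for any [normedModType R[i]].  The product is a field of the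
   structure because the ring and normed-module hierarchies of the libraries
   cannot be joined. *)
HB.mixin Record isCStarAlgebra (R : realType) A
    of CompleteNormedModule R[i] A := {
  cmul : A -> A -> A ;
  star : A -> A ;
  cmulA : forall a b c, cmul a (cmul b c) = cmul (cmul a b) c ;
  cmulDl : forall a b c, cmul (a + b) c = cmul a c + cmul b c ;
  cmulDr : forall a b c, cmul a (b + c) = cmul a b + cmul a c ;
  cmulZl : forall (k : R[i]) a b, cmul (k *: a) b = k *: cmul a b ;
  cmulZr : forall (k : R[i]) a b, cmul a (k *: b) = k *: cmul a b ;
  starK : forall a, star (star a) = a ;
  starD : forall a b, star (a + b) = star a + star b ;
  starZ : forall (k : R[i]) a, star (k *: a) = k^* *: star a ;
  starM : forall a b, star (cmul a b) = cmul (star b) (star a) ;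
  cmul_norm : forall a b : A, `|cmul a b| <= `|a| * `|b| ;
  cstar_identity : forall a : A, `|cmul (star a) a| = `|a| ^+ 2
}.

#[short(type="cstarAlgType")]
HB.structure Definition CStarAlgebra (R : realType) :=
  { A of isCStarAlgebra R A & CompleteNormedModule R[i] A }.

Notation "a ** b" := (cmul a b) (at level 40, left associativity) : ring_scope.

(* The inner product is linear in its second argument. *)
HB.mixin Record isHilbert (R : realType) H
    of CompleteNormedModule R[i] H := {
  dot : H -> H -> R[i] ;
  dotDr : forall u v w, dot u (v + w) = dot u v + dot u w ;
  dotZr : forall (c : R[i]) u v, dot u (c *: v) = c * dot u v ;
  dotC : forall u v, dot u v = (dot v u)^* ;
  dot_norm : forall u : H, dot u u = `|u| ^+ 2
}.

#[short(type="hilbertType")]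
HB.structure Definition Hilbert (R : realType) :=
  { H of isHilbert R H & CompleteNormedModule R[i] H }.

(* Pointedness is only there because measurable types are pointed. *)
HB.mixin Record isTopologicalGroup G of Group G & PointedTopological G := {
  mulg_continuous : continuous (fun p : G * G => (p.1 * p.2)%g) ;
  invg_continuous : continuous (fun g : G => (g^-1)%g)
}.

#[short(type="topGroupType")]
HB.structure Definition TopologicalGroup :=
  { G of isTopologicalGroup G & Group G & PointedTopological G }.

Section CStar.
Context {R : realType} {A : cstarAlgType R}.

Definition cstar_pos (a : A) : Prop := exists b : A, a = star b ** b.

(* The positive square root (unique if it exists). *)
Definition cstar_sqrt (a : A) : A :=
  xget 0 [set b | cstar_pos b /\ b ** b = a].

Definition star_automorphism (f : A -> A) : Prop :=
  [/\ linear f, forall a b, f (a ** b) = f a ** f b,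
      forall a, f (star a) = star (f a) & bijective f].

Definition is_state (phi : A -> R[i]) : Prop :=
  [/\ scalar phi, forall a, 0 <= phi (star a ** a)
    & sup [set complex.Re `|phi a| | a in [set a : A | `|a| <= 1]] = 1].

Definition faithful_state (phi : A -> R[i]) : Prop :=
  forall a, phi (star a ** a) = 0 -> a = 0.

(* [G] acts faithfully, i.e. it is a group of *-automorphisms of [A]. *)
Definition automorphism_group (G : topGroupType) (alpha : G -> A -> A) : Prop :=
  [/\ forall g, star_automorphism (alpha g),
      forall g h, alpha (g * h)%g = alpha g \o alpha h & injective alpha].

(* [x] is the family of the x_g witnessing strong quasi-invariance. *)
Definition strongly_quasi_invariant (G : topGroupType) (alpha : G -> A -> A)
    (phi : A -> R[i]) (x : G -> A) : Prop :=
  forall g, star (x g) = x g /\ forall a, phi (alpha g a) = phi (x g ** a).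

End CStar.

Section Operators.
Context {R : realType} {H : hilbertType R}.
Implicit Types (S T : H -> H) (B : set (H -> H)).

Definition bounded_op T : Prop := linear T /\ continuous T.

Definition adjoint_pair S T : Prop :=
  forall xi eta, dot (S xi) eta = dot xi (T eta).

Definition selfadjoint_op T : Prop := bounded_op T /\ adjoint_pair T T.

Definition op_le S T : Prop := forall xi, dot xi (S xi) <= dot xi (T xi).

Definition positive_op T : Prop := forall xi, 0 <= dot xi (T xi).

Definition opnorm T : R :=
  sup [set complex.Re `|T xi| | xi in [set xi : H | `|xi| <= 1]].

Definition invertible_op T : Prop :=
  bounded_op T /\
  exists S, [/\ bounded_op S, S \o T = idfun & T \o S = idfun].

Definition commutant B : set (H -> H) :=
  [set T | bounded_op T /\ forall S, B S -> S \o T = T \o S].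

Definition von_neumann_algebra B : Prop :=
  (forall S, B S -> exists2 T, B T & adjoint_pair S T) /\
  commutant (commutant B) = B.

Definition vector_state (v : H) T : R[i] := dot v (T v) / `|v| ^+ 2.

Definition faithful_on B (psi : (H -> H) -> R[i]) : Prop :=
  forall T, B T -> positive_op T -> psi T = 0 -> T = 0.

Definition strong_cvg (T : nat -> H -> H) S : Prop :=
  forall xi, T N xi @[N --> \oo] --> S xi.

Definition strong_lim (T : nat -> H -> H) : H -> H :=
  fun xi => lim (T N xi @[N --> \oo]).

Definition weak_cvg (T : nat -> H -> H) S : Prop :=
  forall xi eta,
    (dot xi (T N eta) : R[i]^o) @[N --> \oo] --> (dot xi (S eta) : R[i]^o).

(* Least upper bound in the ordered space of self-adjoint operators. *)
Definition op_sup B T : Prop :=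
  [/\ selfadjoint_op T, forall S, B S -> op_le S T
    & forall S, selfadjoint_op S -> (forall D, B D -> op_le D S) -> op_le T S].

(* Preservation of suprema of bounded increasing nets; such a net is presented
   by its range, an upward directed set. *)
Definition normal_map B (E : (H -> H) -> (H -> H)) : Prop :=
  forall (D : set (H -> H)) T,
    D !=set0 -> D `<=` B -> (forall S, D S -> selfadjoint_op S) ->
    (forall S1 S2, D S1 -> D S2 ->
       exists S, [/\ D S, op_le S1 S & op_le S2 S]) ->
    B T -> op_sup D T -> op_sup (E @` D) (E T).

Record umegaki_expectation (M : set (H -> H)) (psi : (H -> H) -> R[i])
    (B : set (H -> H)) (E : (H -> H) -> (H -> H)) : Prop := {
  umegaki_sub : B `<=` M ;
  umegaki_vN : von_neumann_algebra B ;
  umegaki_linear : forall (c : R[i]) S T, M S -> M T ->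
    E (fun xi => c *: S xi + T xi) = (fun xi => c *: E S xi + E T xi) ;
  umegaki_range : forall T, M T -> B (E T) ;
  umegaki_proj : forall T, B T -> E T = T ;
  umegaki_normal : normal_map M E ;
  umegaki_contractive : forall T, M T -> opnorm (E T) <= opnorm T ;
  umegaki_positive : forall T, M T -> positive_op T -> positive_op (E T) ;
  umegaki_bimodule : forall S T S', M T -> B S -> B S' ->
    E (S \o T \o S') = S \o E T \o S' ;
  umegaki_state : forall T, M T -> psi (E T) = psi T
}.

Definition decreasing_martingale (B : nat -> set (H -> H))
    (E : nat -> (H -> H) -> (H -> H)) (X : nat -> H -> H) : Prop :=
  (forall N, B N (X N)) /\ (forall M N, (M <= N)%N -> E N (X M) = X N).

End Operators.

Section GNS.
Context {R : realType} {A : cstarAlgType R} {H : hilbertType R}.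

Definition gns_representation (phi : A -> R[i]) (pi : A -> H -> H) (Phi : H)
    : Prop :=
  [/\ (forall a, bounded_op (pi a)) /\
        (forall (c : R[i]) a b xi,
           pi (c *: a + b) xi = c *: pi a xi + pi b xi),
      forall a b, pi (a ** b) = pi a \o pi b,
      forall a, adjoint_pair (pi a) (pi (star a)),
      forall a, phi a = dot Phi (pi a Phi)
    & dense (range (fun a => pi a Phi))].

(* The von Neumann algebra generated by the representation. *)
Definition gns_vN (pi : A -> H -> H) : set (H -> H) :=
  commutant (commutant (range pi)).

End GNS.

Section Averages.
Context {R : realType} {G : topGroupType} {H : hilbertType R}.

Definition borel : Type := g_sigma_algebraType (@open G).
HB.instance Definition _ := Measurable.on borel.

Definition subgroup_set (K : set G) : Prop :=
  [/\ K 1%g, forall g h, K g -> K h -> K (g * h)%g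
    & forall g, K g -> K (g^-1)%g].

(* Normalized Haar measure of the compact subgroup [K], viewed as a Borel
   measure on the whole group that is concentrated on [K]; the last clause is
   outer regularity. *)
Definition haar_measure (K : set G) (mu : {measure set borel -> \bar R})
    : Prop :=
  [/\ mu (~` K) = 0%E, mu K = 1%E,
      forall (h : G) (B : set borel), K h -> measurable B ->
        mu ((fun g : G => (h * g)%g) @^-1` B) = mu B
    & forall B : set borel, measurable B ->
        mu B = ereal_inf [set mu V | V in [set V : set G | open V /\ B `<=` V]]].

(* Integral of an operator-valued function in the weak sense. *)
Definition is_op_integral (mu : {measure set borel -> \bar R}) (K : set G)
    (F : G -> H -> H) (T : H -> H) : Prop :=
  bounded_op T /\
  forall xi eta,
    let f := fun g : borel => dot xi (F g eta) in
    [/\ mu.-integrable K (fun g => (complex.Re (f g))%:E),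
        mu.-integrable K (fun g => (complex.Im (f g))%:E)
      & dot xi (T eta) =
        Rintegral mu K (fun g => complex.Re (f g)) +i*
        Rintegral mu K (fun g => complex.Im (f g))].

Definition op_integral (mu : {measure set borel -> \bar R}) (K : set G)
    (F : G -> H -> H) : H -> H :=
  xget 0 [set T | is_op_integral mu K F T].

Definition unitary_representation (U : G -> H -> H) : Prop :=
  [/\ forall g, bounded_op (U g), U 1%g = idfun,
      forall g h, U (g * h)%g = U g \o U h
    & forall g xi eta, dot (U g xi) (U g eta) = dot xi eta].

(* u_g(x) = U_g x U_g^*, where U_g^* = U_(g^-1) for a unitary representation. *)
Definition conj_action (U : G -> H -> H) (g : G) (x : H -> H) : H -> H :=
  U g \o x \o U (g^-1)%g.

Definition fixed_algebra (M : set (H -> H)) (U : G -> H -> H) (K : set G)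
    : set (H -> H) :=
  [set x | M x /\ forall g, K g -> conj_action U g x = x].

Definition average (mu : {measure set borel -> \bar R}) (K : set G)
    (U : G -> H -> H) (x : H -> H) : H -> H :=
  op_integral mu K (fun g => conj_action U g x).

End Averages.
Arguments borel : clear implicits.

(* Main.v *)
Require Import Defs.
From mathcomp Require Import all_boot all_order all_algebra.
From mathcomp Require Import complex ring lra.
From mathcomp Require Import all_classical all_reals all_analysis.
From mathcomp Require Import measurable_realfun.
Set Implicit Arguments.
Unset Strict Implicit.
Unset Printing Implicit Defensive.
Import Order.TTheory GRing.Theory Num.Theory.
Import numFieldNormedType.Exports.
Local Open Scope classical_set_scope.
Local Open Scope ring_scope.
Local Open Scope complex_scope.

(** Let [M] be the von Neumann algebra generated by [pi], and [Om := P_G Phi].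

The whole statement follows from two facts about [Om]: it is fixed by every [U g],
and it is separating for [M].  Fixed, because [P_N] is the orthogonal projection
onto the vectors fixed by [G_N] (left invariance of the Haar measure gives
[U_h P_N = P_N], and [P_N] preserves inner products with fixed vectors), and these
projections decrease to [P_G].  Separating is what faithfulness of [psi_G] says in the first
alternative.  In the second, [U_g Phi = pi (x_(g^-1)^(1/2)) Phi] and the
self-adjointness of [P_N] give [K_N Phi = P_N Phi], hence [P_G Phi = K_G Phi]; and
[K_G] is an invertible element of [M], so it maps the separating vector [Phi] to a
separating vector ([weak_limit_separating]).  On a nonzero space [K_G <> 0], so
[K_N <> 0] for large [N]; since an operator integral that does not exist is [0] by
convention, [K_N] is then a genuine integral.

On a vector fixed by [G_N], the average [E_N T] acts as [P_N T].  Applied to [Om]: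

- [E_N (E_M T)] and [E_N T] are elements of [M] that agree on [Om], so they are
  equal; this is the martingale property ([average_absorb]).
- For [A] in the commutant [M'], [E_N T (A Om) = A (P_N (T Om))] converges to
  [A (P_G (T Om))].  A separating vector for [M] is cyclic for [M']
  ([separating_cyclic]), and the [E_N T] are uniformly bounded, so [E_N T]
  converges strongly ([average_cvg]).

All the properties of [E_infinity] but one pass to the limit from the averages.
Normality uses the formula [E_infinity T (A Om) = A (P_G (T Om))]: the quadratic
form of [E_infinity T] at [A Om] is a matrix coefficient of [T] at [Om], so it is
enough that the least upper bound of an increasing net of self-adjoint operators
is also its weak limit ([op_sup_weak]).  Finally [Fix (u_G)] is the commutant of
[M'] together with the operators [U g], hence a von Neumann algebra.

Most computations are done with the real part [rip] of the inner product, which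
determines it. *)

(** * The real inner product of a complex Hilbert space *)

(** The discriminant bound, shared by all Cauchy-Schwarz inequalities below. *)
Lemma quad_disc (R : realType) (a m c : R) :
  (forall t, 0 <= a + 2 * t * m + t ^+ 2 * c) -> m ^+ 2 <= a * c.
Proof.
move=> h.
have a0 : 0 <= a by have := h 0; rewrite !(mulr0, mul0r, expr0n) /= !addr0.
have [c0|c0] := eqVneq c 0.
  have [->|m0] := eqVneq m 0; first by rewrite c0 expr0n /= mulr0.
  have := h (- (a + 1) / (2 * m)).
  rewrite c0 mulr0 addr0.
  have -> : 2 * (- (a + 1) / (2 * m)) * m = - (a + 1) by field.
  lra.
have c1 : 0 < c.
  rewrite lt_neqAle eq_sym c0 /= leNgt; apply/negP => cn.
  have h1 := h 1; have h2 := h (-1).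
  pose t := (a + 1) * (1 - 1 / c).
  have h3 := h t; have h4 := h (- t).
  have : 0 <= a + t ^+ 2 * c by nra.
  have icn : 1 / c < 0 by rewrite mul1r invr_lt0.
  have e1 : c * (1 - 1 / c) = c - 1 by field.
  have t1 : a + 1 <= t by rewrite /t; nra.
  have e2 : t * c = (a + 1) * (c - 1) by rewrite /t -e1; ring.
  have : t ^+ 2 * c = t * ((a + 1) * (c - 1)) by rewrite -e2; ring.
  move=> ->; nra.
have := h (- m / c).
have -> : a + 2 * (- m / c) * m + (- m / c) ^+ 2 * c = (a * c - m ^+ 2) / c by field.
by rewrite pmulr_lge0 ?invr_gt0// subr_ge0.
Qed.

Lemma le_seq_lim (R : realType) (f g : nat -> R) (l l' : R) :
  f n @[n --> \oo] --> l -> g n @[n --> \oo] --> l' ->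
  (forall n, f n <= g n) -> l <= l'.
Proof. by move=> fl gl fg; apply: ler_cvg_to fl gl _; exact: nearW. Qed.

Section RealPart.
Context {R : realType} {H : hilbertType R}.
Implicit Types u v w : H.

Definition nrm u : R := complex.Re `|u|.
Definition rip u v : R := complex.Re (dot u v).

Lemma normE u : `|u| = (nrm u)%:C.
Proof. by rewrite /nrm RRe_real // ger0_real. Qed.

Lemma nrm_ge0 u : 0 <= nrm u.
Proof. by rewrite -ler0c -normE. Qed.

Lemma nrm_eq0 u : nrm u = 0 -> u = 0.
Proof. by move=> h; apply/eqP; rewrite -normr_eq0 normE h. Qed.

Lemma nrm0 : nrm 0 = 0.
Proof. by rewrite /nrm normr0. Qed.

Lemma nrmN u : nrm (- u) = nrm u.
Proof. by rewrite /nrm normrN. Qed.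

Lemma nrmBC u v : nrm (u - v) = nrm (v - u).
Proof. by rewrite -nrmN opprB. Qed.

Lemma nrmD u v : nrm (u + v) <= nrm u + nrm v.
Proof. by have := ler_normD u v; rewrite !normE -rmorphD lecR. Qed.

Lemma nrmB u v w : nrm (u - w) <= nrm (u - v) + nrm (v - w).
Proof. by apply: le_trans (nrmD _ _); rewrite addrA subrK. Qed.

Lemma nrmZ (c : R[i]) u : nrm (c *: u) = complex.Re `|c| * nrm u.
Proof.
rewrite /nrm normrZ [`|u|]normE -[`|c|]RRe_real ?ger0_real //.
by rewrite -rmorphM.
Qed.

Lemma nrmZr (t : R) u : nrm (t%:C *: u) = `|t| * nrm u.
Proof. by rewrite nrmZ normc_def /= expr0n /= addr0 sqrtr_sqr. Qed.

Lemma ripDr u v w : rip u (v + w) = rip u v + rip u w.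
Proof. by rewrite /rip dotDr; case: (dot u v) (dot u w) => ? ? []. Qed.

Lemma ripC u v : rip u v = rip v u.
Proof. by rewrite /rip dotC; case: (dot v u). Qed.

Lemma ripDl u v w : rip (v + w) u = rip v u + rip w u.
Proof. by rewrite ripC ripDr ![rip u _]ripC. Qed.

Lemma dotZl (c : R[i]) u v : dot (c *: u) v = conjc c * dot u v.
Proof. by rewrite dotC dotZr rmorphM/= -dotC. Qed.

Lemma dotBr u v w : dot u (v - w) = dot u v - dot u w.
Proof. by rewrite dotDr -scaleN1r dotZr mulN1r. Qed.

Lemma dotBl u v w : dot (u - v) w = dot u w - dot v w.
Proof. by rewrite dotC dotBr rmorphB/= -!dotC. Qed.

Lemma ripZ (c : R[i]) u v : rip u (c *: v) = rip (conjc c *: u) v.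
Proof. by rewrite /rip dotZl dotZr conjcK. Qed.

Lemma ripZr (t : R) u v : rip u (t%:C *: v) = t * rip u v.
Proof.
by rewrite /rip dotZr; case: (dot u v) => a b /=; rewrite mul0r subr0.
Qed.

Lemma ripZl (t : R) u v : rip (t%:C *: u) v = t * rip u v.
Proof. by rewrite ripC ripZr ripC. Qed.

Lemma rip0r u : rip u 0 = 0.
Proof. by have := ripZr 0 u 0; rewrite mul0r scaler0. Qed.

Lemma rip0l u : rip 0 u = 0.
Proof. by rewrite ripC rip0r. Qed.

Lemma ripNr u v : rip u (- v) = - rip u v.
Proof. by apply/eqP; rewrite -subr_eq0 opprK -ripDr addNr rip0r. Qed.

Lemma ripNl u v : rip (- u) v = - rip u v.
Proof. by rewrite ripC ripNr ripC. Qed.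

Lemma ripBr u v w : rip u (v - w) = rip u v - rip u w.
Proof. by rewrite ripDr ripNr. Qed.

Lemma ripBl u v w : rip (v - w) u = rip v u - rip w u.
Proof. by rewrite ripDl ripNl. Qed.

Lemma rip_nrm u : rip u u = nrm u ^+ 2.
Proof. by rewrite /rip dot_norm normE -rmorphXn. Qed.

Lemma Im_dot u v : complex.Im (dot u v) = rip ('i%C *: u) v.
Proof. by rewrite /rip dotZl; case: (dot u v) => a b /=; ring. Qed.

Lemma dotE u v : dot u v = rip u v +i* rip ('i%C *: u) v.
Proof. by rewrite -Im_dot /rip; case: (dot u v). Qed.

Lemma dot_ext u1 v1 u2 v2 :
  rip u1 v1 = rip u2 v2 -> rip ('i%C *: u1) v1 = rip ('i%C *: u2) v2 ->
  dot u1 v1 = dot u2 v2.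
Proof. by rewrite !dotE => -> ->. Qed.

Lemma nrm_sqrD u v : nrm (u + v) ^+ 2 = nrm u ^+ 2 + 2 * rip u v + nrm v ^+ 2.
Proof. by rewrite -!rip_nrm ripDl !ripDr (ripC v u); ring. Qed.

Lemma nrm_sqrB u v : nrm (u - v) ^+ 2 = nrm u ^+ 2 - 2 * rip u v + nrm v ^+ 2.
Proof. by rewrite nrm_sqrD ripNr nrmN; ring. Qed.

Lemma rip_CS u v : `|rip u v| <= nrm u * nrm v.
Proof.
have : rip u v ^+ 2 <= nrm u ^+ 2 * nrm v ^+ 2.
  apply: quad_disc => t.
  have := sqr_ge0 (nrm (u + t%:C *: v)).
  rewrite nrm_sqrD ripZr nrmZr exprMn real_normK ?num_real//.
  by move=> h; apply: le_trans h _; lra.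
rewrite -exprMn -[X in X <= _]real_normK ?num_real//.
by rewrite ler_sqr// ?nnegrE ?normr_ge0// mulr_ge0 ?nrm_ge0.
Qed.

Lemma rip_ext u v : (forall w, rip w u = rip w v) -> u = v.
Proof.
move=> h; apply/eqP; rewrite -subr_eq0; apply/eqP/nrm_eq0/eqP.
by rewrite -sqrf_eq0 -rip_nrm ripBr h subrr.
Qed.

Lemma nrm_cvgP (u : nat -> H) l :
  u n @[n --> \oo] --> l <->
  forall e : R, 0 < e -> exists N, forall n, (N <= n)%N -> nrm (u n - l) < e.
Proof.
split.
  move=> /cvgrPdist_lt h e e0.
  have /h [N _ hN] : 0 < e%:C by rewrite ltcR.
  by exists N => n Nn; have := hN n Nn; rewrite /= normE ltcR nrmBC.
move=> h; apply/cvgrPdist_lt => e e0.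
have eE : e = (complex.Re e)%:C by rewrite RRe_real // gtr0_real.
have /h[N hN] : 0 < complex.Re e by rewrite -ltcR -eE.
exists N => // n Nn; rewrite /= eE normE ltcR nrmBC; exact: hN.
Qed.

Lemma nrm_complete (u : nat -> H) :
  (forall e : R, 0 < e -> exists N, forall m n, (N <= m)%N -> (N <= n)%N ->
     nrm (u m - u n) < e) ->
  exists l : H, u n @[n --> \oo] --> l.
Proof.
move=> h.
apply/(@cvg_ex H)/(@cauchy_cvgP H)/cauchy_ballP => e e0.
have eE : e = (complex.Re e)%:C by rewrite RRe_real // gtr0_real.
have /h[N hN] : 0 < complex.Re e by rewrite -ltcR -eE.
exists (u @` [set n | (N <= n)%N], u @` [set n | (N <= n)%N]).
  by split; exists N => // n Nn; exists n.
move=> [_ _] [/= [m Nm <-] [n Nn <-]].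
rewrite -ball_normE /= eE normE ltcR; exact: hN.
Qed.

Lemma rip_cvg2 {T : Type} {F : set_system T} {FF : Filter F} (a b : T -> H) l m :
  a x @[x --> F] --> l -> b x @[x --> F] --> m ->
  rip (a x) (b x) @[x --> F] --> rip l m.
Proof.
move=> /cvgrPdist_lt ha /cvgrPdist_lt hb; apply/cvgrPdist_lt => e e0.
pose c := nrm l + nrm m + 1.
have c0 : 0 < c by rewrite /c; have := nrm_ge0 l; have := nrm_ge0 m; lra.
pose d := Num.min 1 (e / c).
have d0 : 0 < d by rewrite lt_min ltr01 divr_gt0.
have d1 : d <= 1 by rewrite ge_min lexx.
have dc : d * c <= e by rewrite -ler_pdivlMr// ge_min lexx orbT.
have dC : 0 < d%:C by rewrite ltcR.
near=> x.
have h1 : nrm (l - a x) < d by rewrite -ltcR -normE; near: x; exact: ha.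
have h2 : nrm (m - b x) < d by rewrite -ltcR -normE; near: x; exact: hb.
have -> : rip l m - rip (a x) (b x) = rip (l - a x) (b x) + rip l (m - b x).
  by rewrite ripBl ripBr; ring.
apply: le_lt_trans (ler_normD _ _) _.
have h3 := rip_CS (l - a x) (b x); have h4 := rip_CS l (m - b x).
have h5 : nrm (b x) <= nrm m + 1.
  have := nrmB (b x) m 0; rewrite !subr0 (nrmBC _ m); lra.
have := nrm_ge0 (b x); have := nrm_ge0 l; have := nrm_ge0 m.
have := nrm_ge0 (l - a x); have := nrm_ge0 (m - b x).
rewrite /c in dc; nra.
Unshelve. all: by end_near.
Qed.

Lemma rip_cvg (u : nat -> H) l w :
  u n @[n --> \oo] --> l -> rip w (u n) @[n --> \oo] --> rip w l.
Proof. by move=> ul; apply: rip_cvg2 => //; exact: cvg_cst. Qed.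

Lemma nrm_cvg (u : nat -> H) l :
  u n @[n --> \oo] --> l -> nrm (u n) @[n --> \oo] --> nrm l.
Proof.
move=> /nrm_cvgP h; apply/cvgrPdist_lt => e e0.
have /h[N hN] := e0; exists N => // n Nn /=.
have := hN n Nn; have := nrmB (u n) l 0; have := nrmB l (u n) 0.
rewrite !subr0 (nrmBC l) => h1 h2 h3.
by rewrite ltr_norml; apply/andP; split; lra.
Qed.

End RealPart.

Arguments rip_cvg {R H u l} w _.

(** * Riesz representation, adjoints and commutants *)

Section BoundedOperators.
Context {R : realType} {H : hilbertType R}.
Implicit Types (u v w : H) (S T : H -> H) (B : set (H -> H)).

Lemma lin0 T : linear T -> T 0 = 0.
Proof.
move=> lT; have := lT 1 0 0; rewrite !scale1r addr0 => h.
by apply: (addIr (T 0)); rewrite add0r -h.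
Qed.

Lemma linD T u v : linear T -> T (u + v) = T u + T v.
Proof. by move=> lT; have := lT 1 u v; rewrite !scale1r. Qed.

Lemma linZ T (c : R[i]) u : linear T -> T (c *: u) = c *: T u.
Proof. by move=> lT; have := lT c u 0; rewrite addr0 lin0// addr0. Qed.

Lemma linN T u : linear T -> T (- u) = - T u.
Proof. by move=> lT; rewrite -scaleN1r linZ// scaleN1r. Qed.

Lemma linB T u v : linear T -> T (u - v) = T u - T v.
Proof. by move=> lT; rewrite linD// linN. Qed.

Lemma bounded_op_lin T : bounded_op T -> linear T.
Proof. by case. Qed.
Hint Resolve bounded_op_lin : core.

Lemma bounded_op_bound T : bounded_op T ->
  exists2 C : R, 0 <= C & forall u, nrm (T u) <= C * nrm u.
Proof.
move=> [lT cT].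
have /cvgrPdist_lt/(_ _ (@ltr01 R[i])) := cT 0.
rewrite lin0// => /nbhs_ballP[d /= d0 hd].
have dE : d = (complex.Re d)%:C by rewrite RRe_real // gtr0_real.
have e0 : 0 < complex.Re d by rewrite -ltcR -dE.
move: (complex.Re d) dE e0 => e dE e0.
have he u : nrm u < e -> nrm (T u) < 1.
  move=> hu; have := hd u; rewrite -ball_normE /= !sub0r !normrN !normE dE !ltcR.
  exact.
exists (2 / e); first by rewrite divr_ge0// ltW.
move=> u; have [u0|u0] := eqVneq (nrm u) 0.
  by rewrite (nrm_eq0 u0) lin0// nrm0 mulr0.
have up : 0 < nrm u by rewrite lt_neqAle eq_sym u0 nrm_ge0.
have t0 : 0 < e / (2 * nrm u) by rewrite divr_gt0// mulr_gt0.
have := he ((e / (2 * nrm u))%:C *: u).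
rewrite linZ// !nrmZr gtr0_norm//.
have -> : e / (2 * nrm u) * nrm u = e / 2 by field.
move=> /(_ ltac:(lra)); rewrite -ltr_pdivlMl// => /ltW/le_trans; apply.
by rewrite mulr1 invf_div mulrAC.
Qed.

Lemma bound_bounded_op T (C : R) :
  linear T -> (forall u, nrm (T u) <= C * nrm u) -> bounded_op T.
Proof.
move=> lT hC; split=> // u.
apply/cvgrPdist_lt => e e0.
have eE : e = (complex.Re e)%:C by rewrite RRe_real // gtr0_real.
have ep : 0 < complex.Re e by rewrite -ltcR -eE.
have C1 : 0 < `|C| + 1 by have := normr_ge0 C; lra.
apply/nbhs_ballP; exists (complex.Re e / (`|C| + 1))%:C => /=.
  by rewrite ltcR divr_gt0.
move=> v; rewrite -ball_normE /= -linB// eE !normE !ltcR ltr_pdivlMr// => h.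
have := hC (u - v); have := nrm_ge0 (u - v); have := ler_norm C; nra.
Qed.

Lemma bounded_op_id : bounded_op (idfun : H -> H).
Proof. by apply: (@bound_bounded_op _ 1) => // u; rewrite mul1r. Qed.

Lemma bounded_op_comp S T : bounded_op S -> bounded_op T -> bounded_op (S \o T).
Proof.
move=> bS bT; have [C C0 hC] := bounded_op_bound bS.
have [D D0 hD] := bounded_op_bound bT.
apply: (@bound_bounded_op _ (C * D)) => [c u v|u].
  by rewrite /= (bounded_op_lin bT) (bounded_op_lin bS).
by rewrite /= (le_trans (hC _))// -mulrA ler_wpM2l.
Qed.

Lemma bounded_op_lincomb (c : R[i]) S T : bounded_op S -> bounded_op T ->
  bounded_op (fun u => c *: S u + T u).
Proof.
move=> bS bT; have [C C0 hC] := bounded_op_bound bS.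
have [D D0 hD] := bounded_op_bound bT.
apply: (@bound_bounded_op _ (complex.Re `|c| * C + D)) => [d u v|u].
  rewrite (bounded_op_lin bT) (bounded_op_lin bS) !scalerDr !scalerA.
  by rewrite mulrC addrACA.
rewrite (le_trans (nrmD _ _))// nrmZ mulrDl lerD// -mulrA ler_wpM2l//.
by rewrite -ler0c RRe_real// ger0_real.
Qed.

Lemma bounded_op_cvg T (u : nat -> H) l : bounded_op T ->
  u n @[n --> \oo] --> l -> T (u n) @[n --> \oo] --> T l.
Proof. by move=> [_ cT] /cvg_comp; apply; apply: cT. Qed.

(** Orthogonal projections, adjoints and operators defined by bounded forms all
come from this one minimization: completeness gives a minimizer [w] of
[|v|^2 - 2 f v] on a closed real subspace, and the first variation at [w] says
that [f] is the scalar product with [w]. *)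
Lemma riesz_closed (W : set H) (f : H -> R) (C : R) :
  W 0 -> (forall u v, W u -> W v -> W (u + v)) ->
  (forall (t : R) u, W u -> W (t%:C *: u)) ->
  (forall (u : nat -> H) l, (forall n, W (u n)) -> u n @[n --> \oo] --> l -> W l) ->
  (forall u v, f (u + v) = f u + f v) -> (forall (t : R) u, f (t%:C *: u) = t * f u) ->
  (forall u, `|f u| <= C * nrm u) ->
  exists2 w, W w & forall v, W v -> rip w v = f v.
Proof.
move=> W0 WD WZ Wcl fD fZ fC.
pose J v := nrm v ^+ 2 - 2 * f v.
pose S := [set J v | v in W].
have hS : has_inf S.
  split; first by exists (J 0), 0.
  exists (- C ^+ 2) => _ [v Wv <-]; rewrite /J.
  have := fC v; have := ler_norm (f v); have := sqr_ge0 (nrm v - C); nra.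
pose m := inf S.
have mle v : W v -> m <= J v.
  by move=> Wv; apply: ge_inf; [exact: hS.2|exists v].
have ex n : exists v, W v /\ J v < m + n.+1%:R^-1.
  have /inf_adherent/(_ hS)[_ [v Wv <-] hv] : 0 < n.+1%:R^-1 :> R by rewrite invr_gt0.
  by exists v.
have [u hu] := choice ex.
have hun n : W (u n) := (hu n).1.
have JuE n : J (u n) < m + n.+1%:R^-1 := (hu n).2.
have dist n k : nrm (u n - u k) ^+ 2 <= 2 * n.+1%:R^-1 + 2 * k.+1%:R^-1.
  have Wm : W ((2^-1)%:C *: (u n + u k)) by apply: WZ; apply: WD.
  have := mle _ Wm; rewrite /J fZ fD nrmZr gtr0_norm ?invr_gt0//.
  rewrite exprMn nrm_sqrB nrm_sqrD.
  have := JuE n; have := JuE k; rewrite /J.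
  move: (n.+1%:R^-1) (k.+1%:R^-1) => a b h1 h2 h3.
  have : (2^-1 : R) ^+ 2 = 4^-1 by field.
  move=> h4; rewrite h4 in h3; lra.
have inv_lt (e : R) : 0 < e -> exists N, forall n, (N <= n)%N -> n.+1%:R^-1 < e.
  move=> e0; have := @cvg_harmonic R; move=> /cvgrPdist_lt/(_ _ e0)[N _ hN].
  exists N => n Nn; have := hN n Nn; rewrite /= sub0r normrN.
  by rewrite gtr0_norm// invr_gt0.
have [w uw] : exists w : H, u n @[n --> \oo] --> w.
  apply: nrm_complete => e e0.
  have [N hN] := inv_lt (e ^+ 2 / 4) (ltac:(by rewrite divr_gt0// exprn_gt0)).
  exists N => n k Nn Nk; have := dist n k; have := hN n Nn; have := hN k Nk.
  move=> h1 h2 h3; rewrite -ltr_sqr ?nnegrE ?nrm_ge0 ?ltW//.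
  move: (e ^+ 2) (n.+1%:R^-1) (k.+1%:R^-1) h1 h2 h3 => e2 a b; lra.
exists w; first exact: Wcl uw.
move=> v Wv.
(* First variation of [J] along [v], written as a limit along [u n]. *)
have var t : 0 <= 0 + 2 * t * (rip w v - f v) + t ^+ 2 * nrm v ^+ 2.
  have lt n : - n.+1%:R^-1 <= 2 * t * (rip v (u n) - f v) + t ^+ 2 * nrm v ^+ 2.
    have := mle _ (WD _ _ (hun n) (WZ t _ Wv)).
    have := JuE n; rewrite /J fD fZ nrm_sqrD nrmZr exprMn real_normK ?num_real//.
    rewrite ripZr (ripC v); move: (n.+1%:R^-1) => a h1 h2; lra.
  rewrite add0r ripC.
  have c1 : (2 * t * (rip v (u n) - f v) + t ^+ 2 * nrm v ^+ 2) @[n --> \oo]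
      --> 2 * t * (rip v w - f v) + t ^+ 2 * nrm v ^+ 2.
    apply: cvgD; last exact: cvg_cst.
    apply: cvgM; first exact: cvg_cst.
    apply: cvgB; last exact: cvg_cst.
    exact: rip_cvg.
  have c2 : - (n.+1%:R^-1 : R) @[n --> \oo] --> - 0.
    by apply: cvgN; apply: cvg_harmonic.
  by rewrite -oppr0; apply: le_seq_lim c2 c1 lt.
have := quad_disc var; rewrite mul0r => h.
by apply/eqP; rewrite -subr_eq0 -sqrf_eq0 eq_le h sqr_ge0.
Qed.

(** The rule for [b u (c *: v)] is what makes the operator, obtained from the real
form by [riesz_closed], linear over the complex numbers. *)
Lemma form_op (b : H -> H -> R) (C : R) :
  (forall u v w, b (u + v) w = b u w + b v w) ->
  (forall (t : R) u w, b (t%:C *: u) w = t * b u w) ->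
  (forall u v w, b u (v + w) = b u v + b u w) ->
  (forall (c : R[i]) u v, b u (c *: v) = b (conjc c *: u) v) ->
  (forall u v, `|b u v| <= C * nrm u * nrm v) ->
  exists2 T, bounded_op T & forall u v, rip u (T v) = b u v.
Proof.
move=> bDl bZl bDr bZr bC.
have ex v : exists w, forall u, rip u w = b u v.
  have [//|//|//|//| | | |w _ hw] :=
      @riesz_closed setT (fun u => b u v) (C * nrm v).
  - by move=> *; apply: bDl.
  - by move=> *; apply: bZl.
  - by move=> u; rewrite mulrAC.
  - by exists w => u; rewrite ripC hw.
have [T hT] := choice ex.
exists T; last by move=> u v; apply: hT.
have lT : linear T.
  move=> c u v; apply: rip_ext => w.
  by rewrite hT bDr bZr ripDr ripZ !hT.
apply: (@bound_bounded_op _ C) => // u.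
have [->|h] := eqVneq (nrm (T u)) 0.
  have := le_trans (normr_ge0 _) (bC u u).
  have := nrm_ge0 u; rewrite le_eqVlt => /predU1P[<-|h]; first by rewrite !mulr0.
  by rewrite pmulr_lge0.
have Tp : 0 < nrm (T u) by rewrite lt_neqAle eq_sym h nrm_ge0.
rewrite -(ler_pM2l Tp) -expr2 -rip_nrm hT.
by rewrite (le_trans (ler_norm _))// (le_trans (bC _ _))// mulrAC mulrC.
Qed.

Lemma adjoint_rip S T : linear S -> (forall u v, rip (S u) v = rip u (T v)) ->
  adjoint_pair S T.
Proof. by move=> lS h u v; apply: dot_ext; rewrite ?h// -linZ// h. Qed.

Lemma adjoint_pair_rip S T : adjoint_pair S T ->
  forall u v, rip (S u) v = rip u (T v).
Proof. by move=> h u v; rewrite /rip h. Qed.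

Lemma adjoint_pairC S T : adjoint_pair S T -> adjoint_pair T S.
Proof. by move=> h u v; rewrite dotC -h -dotC. Qed.

Lemma adjoint_ex S : bounded_op S -> exists2 T, bounded_op T & adjoint_pair S T.
Proof.
move=> bS; have lS := bounded_op_lin bS; have [C C0 hC] := bounded_op_bound bS.
have [||||u v|T bT hT] := @form_op (fun u v => rip (S u) v) C.
- by move=> u v w; rewrite linD// ripDl.
- by move=> t u w; rewrite linZ// ripZl.
- by move=> u v w; rewrite ripDr.
- by move=> c u v; rewrite ripZ linZ.
- rewrite (le_trans (rip_CS _ _))// ler_wpM2r ?nrm_ge0//.
- by exists T => //; apply: adjoint_rip.
Qed.

Lemma adjoint_pair_comp S S' T T' : adjoint_pair S S' -> adjoint_pair T T' ->
  adjoint_pair (S \o T) (T' \o S').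
Proof. by move=> h1 h2 u v; rewrite /= h1 h2. Qed.

Lemma adjoint_unique S T T' : adjoint_pair S T -> adjoint_pair S T' -> T = T'.
Proof.
move=> h1 h2; apply/funext => u; apply: rip_ext => v.
by rewrite -(adjoint_pair_rip h1) (adjoint_pair_rip h2).
Qed.

Lemma commutantS B B' : B `<=` B' -> commutant B' `<=` commutant B.
Proof. by move=> sB T [bT h]; split=> // S /sB /h. Qed.

Lemma commutant_bicommutant B : B `<=` bounded_op -> B `<=` commutant (commutant B).
Proof. by move=> bB S BS; split=> [|T [bT h]]; [exact: bB|rewrite h]. Qed.

Lemma commutant3 B : B `<=` bounded_op ->
  commutant (commutant (commutant B)) = commutant B.
Proof.
move=> bB; apply/seteqP; split.
  exact/commutantS/commutant_bicommutant.
by apply: commutant_bicommutant => T [].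
Qed.

(** Taking adjoints in [S \o A' = A' \o S] for the adjoint [A'] of [A] gives
[A \o T = T \o A]. *)
Lemma commutant_adjoint B S :
  (forall S, B S -> exists2 T, B T & adjoint_pair S T) ->
  commutant B S -> exists2 T, commutant B T & adjoint_pair S T.
Proof.
move=> aB [bS hS]; have [T bT ST] := adjoint_ex bS.
exists T => //; split=> // A BA; have [A' BA' AA'] := aB _ BA.
apply: (@adjoint_unique (A' \o S)).
  by rewrite hS//; apply: adjoint_pair_comp ST (adjoint_pairC AA').
exact: adjoint_pair_comp (adjoint_pairC AA') ST.
Qed.

End BoundedOperators.

(** * Integration of continuous functions over a compact subgroup *)

Section Haar.
Context {R : realType} {G : topGroupType}.
Variables (K : set G) (mu : {measure set (borel G) -> \bar R}).
Hypotheses (hausG : hausdorff_space G) (cK : compact K).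
Hypotheses (gK : subgroup_set K) (haar : haar_measure K mu).

Local Notation KB := (K : set (borel G)).
Local Notation RI f := (Rintegral mu KB f).

Lemma open_borel (V : set G) : open V -> measurable (V : set (borel G)).
Proof. by move=> oV; apply: sub_sigma_algebra. Qed.

Lemma measurable_subgroup : measurable KB.
Proof.
rewrite -(setCK K); apply: measurableC; apply: open_borel.
by apply: closed_openC; exact: compact_closed.
Qed.

Lemma continuous_borel (f : G -> R) :
  {within K, continuous f} -> measurable_fun KB (f : borel G -> R).
Proof.
move=> /continuousP cf; apply: (measurability _ (RGenOpens.measurableE R)).
move=> _ [_ [a [b ->] <-]].
have /cf/open_subspaceP[V oV VK] : open (`]a, b[%classic : set R).
  exact: interval_open.
rewrite setIC -VK; apply: measurableI; last exact: measurable_subgroup.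
exact: open_borel.
Qed.

Lemma haar1 : fine (mu KB) = 1.
Proof. by have [_ -> _ _] := haar. Qed.

Lemma continuous_integrable (f : G -> R) (C : R) :
  {within K, continuous f} -> (forall g, K g -> `|f g| <= C) ->
  mu.-integrable KB (EFin \o f).
Proof.
move=> cf fC; apply: measurable_bounded_integrable.
- exact: measurable_subgroup.
- by have [_ -> _ _] := haar; rewrite ltry.
- exact: continuous_borel.
- by exists C; split; [exact: num_real|move=> D /ltW CD g Kg; exact: le_trans (fC g Kg) CD].
Qed.

Lemma shift_borel (h : G) :
  measurable_fun setT ((fun g => (h * g)%g) : borel G -> borel G).
Proof.
apply: (@measurability _ _ (borel G) (borel G) setT _ (@open G)) => //.
move=> _ [V oV <-]; rewrite setTI; apply: open_borel.
have /continuousP : continuous (fun g : G => (h * g)%g); last exact.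
move=> g; have := @mulg_continuous G (h, g).
apply: (@continuous_comp _ _ _ (fun g => (h, g))).
by apply: cvg_pair; [exact: cvg_cst|exact: cvg_id].
Qed.

Lemma subgroup_shift (h : G) : K h -> (fun g => (h * g)%g) @^-1` K = K.
Proof.
have [K1 KM KV] := gK; move=> Kh; apply/seteqP; split=> g /=.
  by move=> /(KM _ _ (KV _ Kh)); rewrite mulKg.
exact: KM.
Qed.

Lemma Rintegral_addC (f : G -> R) (C : R) :
  mu.-integrable KB (EFin \o f) -> RI (fun g => f g + C) = RI f + C.
Proof.
move=> fi; rewrite RintegralD//=; first by rewrite Rintegral_cst ?haar1 ?mulr1//; exact: measurable_subgroup.
- exact: measurable_subgroup.
- apply: (@continuous_integrable (fun=> C) `|C|) => // g; exact: cvg_cst.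
Qed.

(** Adding the bound [C] makes the integrand nonnegative, so that the change of
variables for nonnegative functions and the invariance of the measure on Borel
sets apply. *)
Lemma Rintegral_shift (f : G -> R) (C : R) (h : G) : K h ->
  {within K, continuous f} -> (forall g, K g -> `|f g| <= C) ->
  {within K, continuous (fun g => f (h * g)%g)} ->
  RI (fun g => f (h * g)%g) = RI f.
Proof.
move=> Kh cf fC cfh.
have fi := continuous_integrable cf fC.
have Kmul g : K g -> K (h * g)%g by have [_ KM _] := gK; exact: KM.
have fhi : mu.-integrable KB (EFin \o (fun g => f (h * g)%g)).
  by apply: continuous_integrable cfh _ => g Kg; exact/fC/Kmul.
apply: (addIr C); rewrite -!Rintegral_addC//.
have mK := measurable_subgroup.
rewrite /Rintegral; congr fine.
pose L := (fun g => (h * g)%g) : borel G -> borel G.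
have := @ge0_integral_pushforward _ _ _ _ R L (shift_borel h) mu KB
  (fun g => (f g + C)%:E) mK.
rewrite /L subgroup_shift//= => <-.
- apply: eq_measure_integral => [|mL A mA _]; first exact: shift_borel.
  by rewrite /= /pushforward; have [_ _ + _] := haar; apply.
- apply/measurable_EFinP; apply: measurable_funD; first exact: continuous_borel.
  exact: measurable_cst.
- move=> g; rewrite inE => Kg; rewrite lee_fin.
  have := fC g Kg; rewrite ler_norml => /andP[]; lra.
Qed.

End Haar.

(** * Weak operator integrals *)

Section OperatorIntegrals.
Context {R : realType} {G : topGroupType} {H : hilbertType R}.
Variables (K : set G) (mu : {measure set (borel G) -> \bar R}).
Hypotheses (hausG : hausdorff_space G) (cK : compact K).
Hypotheses (gK : subgroup_set K) (haar : haar_measure K mu).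
Implicit Types (u v : H) (S T : H -> H) (F : G -> H -> H).

Local Notation KB := (K : set (borel G)).
Local Notation RI f := (Rintegral mu KB f).
Local Notation measurableK := (measurable_subgroup hausG cK).

(** The integrands met below: uniformly bounded on [K] and weakly continuous, which
is enough for the weak integral over [K] to exist. *)
Definition weak_family F (C : R) : Prop :=
  [/\ forall g, K g -> linear (F g),
      forall g u, K g -> nrm (F g u) <= C * nrm u
    & forall u v, {within K, continuous (fun g => rip u (F g v))}].

Lemma weak_family_rip_le F C u v g : weak_family F C -> K g ->
  `|rip u (F g v)| <= C * nrm u * nrm v.
Proof.
move=> [_ FC _] Kg; rewrite (le_trans (rip_CS _ _))// [leRHS]mulrAC [leRHS]mulrC.
by rewrite ler_wpM2l ?nrm_ge0 ?FC.
Qed.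

Lemma weak_family_integrable F C u v : weak_family F C ->
  mu.-integrable KB (EFin \o (fun g => rip u (F g v))).
Proof.
move=> hF; apply: (continuous_integrable hausG cK haar _ _).
  by have [_ _ +] := hF; apply.
by move=> g Kg; exact: weak_family_rip_le hF Kg.
Qed.

Lemma Rintegral_cst1 (c : R) : RI (fun=> c) = c.
Proof. by rewrite Rintegral_cst ?(haar1 haar) ?mulr1//; exact: measurableK. Qed.

Lemma weak_family_integral_le F C u v : weak_family F C ->
  `|RI (fun g => rip u (F g v))| <= C * nrm u * nrm v.
Proof.
move=> hF; have fi := weak_family_integrable u v hF.
rewrite (le_trans (le_normr_Rintegral measurableK fi))//.
rewrite -[leRHS]Rintegral_cst1; apply: le_Rintegral; first exact: measurableK.
- exact: (integrable_norm fi).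
- apply: (@continuous_integrable _ _ _ _ hausG cK haar (fun=> _) `|C * nrm u * nrm v|) => //.
  by move=> g; exact: cvg_cst.
- by move=> g Kg; exact: weak_family_rip_le hF Kg.
Qed.

Lemma op_integral_exists F C : weak_family F C ->
  exists T, is_op_integral mu K F T.
Proof.
move=> hF; have fi u v := weak_family_integrable u v hF.
have [lF _ _] := hF.
have [||||u v|T bT hT] := @form_op _ H (fun u v => RI (fun g => rip u (F g v))) C.
- move=> u v w; rewrite -RintegralD//; last exact: measurableK.
  by apply: eq_Rintegral => g _; rewrite ripDl.
- move=> t u w; rewrite -RintegralZl//; last exact: measurableK.
  by apply: eq_Rintegral => g _; rewrite ripZl.
- move=> u v w; rewrite -RintegralD//; last exact: measurableK.
  by apply: eq_Rintegral => g; rewrite inE => Kg; rewrite linD ?ripDr//; exact: lF.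
- move=> c u v.
  by apply: eq_Rintegral => g; rewrite inE => Kg; rewrite linZ ?ripZ//; exact: lF.
- exact: weak_family_integral_le hF.
exists T; split=> // u v f.
have fIm : (fun g => complex.Im (f g)) = (fun g => rip ('i%C *: u) (F g v)).
  by apply/funext => g; rewrite /f Im_dot.
split; [exact: fi| |by rewrite dotE !hT -fIm].
have := fi ('i%C *: u) v; rewrite -fIm; exact.
Qed.

Lemma op_integralP F C : weak_family F C ->
  is_op_integral mu K F (op_integral mu K F).
Proof.
move=> /op_integral_exists[T hT].
by apply: (@xgetPex _ 0 [set T | is_op_integral mu K F T]); exists T.
Qed.

Lemma op_integral_rip F T u v : is_op_integral mu K F T ->
  rip u (T v) = RI (fun g => rip u (F g v)).
Proof. by move=> [_ /(_ u v)[_ _ h]]; rewrite {1}/rip h. Qed.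

(** The bound is obtained at [u] against the vector [op_integral mu K F u] itself. *)
Lemma op_integral_nrm F C u : weak_family F C ->
  nrm (op_integral mu K F u) <= C * nrm u.
Proof.
move=> hF; set T := op_integral mu K F.
have := weak_family_integral_le (T u) u hF.
rewrite -(op_integral_rip _ _ (op_integralP hF)) -/T rip_nrm => h.
have [T0|T0] := eqVneq (nrm (T u)) 0.
  rewrite T0; have [K1 _ _] := gK; have [_ /(_ _ u K1) + _] := hF.
  by apply: le_trans; exact: nrm_ge0.
have Tp : 0 < nrm (T u) by rewrite lt_neqAle eq_sym T0 nrm_ge0.
rewrite -(ler_pM2l Tp) -expr2 (le_trans (ler_norm _))// (le_trans h)//.
by rewrite mulrAC mulrC.
Qed.

(** [S] is moved across the weak integral through its adjoint. *)
Lemma op_integral_commute F T S : is_op_integral mu K F T -> bounded_op S ->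
  (forall g, K g -> S \o F g = F g \o S) -> S \o T = T \o S.
Proof.
move=> hF bS SF; have [S' bS' SS'] := adjoint_ex bS.
apply/funext => v; apply: rip_ext => u /=.
rewrite -(adjoint_pair_rip (adjoint_pairC SS')) !(op_integral_rip _ _ hF).
apply: eq_Rintegral => g; rewrite inE => Kg.
have /(congr1 (fun f => f v)) /= <- := SF g Kg.
by rewrite -(adjoint_pair_rip (adjoint_pairC SS')).
Qed.

End OperatorIntegrals.

(** * Averages over a compact group of unitaries *)

Section Unitary.
Context {R : realType} {G : topGroupType} {H : hilbertType R}.
Variables (U : G -> H -> H).
Hypothesis (uU : unitary_representation U).
Implicit Types (u v : H) (S T : H -> H) (g h : G).

Lemma U_bounded g : bounded_op (U g).
Proof. by have [] := uU. Qed.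

Lemma U_lin g : linear (U g).
Proof. exact/bounded_op_lin/U_bounded. Qed.

Lemma U_mul g h u : U (g * h)%g u = U g (U h u).
Proof. by have [_ _ -> _] := uU. Qed.

Lemma U_K g u : U g (U g^-1%g u) = u.
Proof. by rewrite -U_mul mulgV; have [_ -> _ _] := uU. Qed.

Lemma U_VK g u : U g^-1%g (U g u) = u.
Proof. by rewrite -U_mul mulVg; have [_ -> _ _] := uU. Qed.

Lemma U_dot g u v : dot (U g u) (U g v) = dot u v.
Proof. by have [_ _ _ ->] := uU. Qed.

Lemma U_adj g : adjoint_pair (U g) (U g^-1%g).
Proof. by move=> u v; rewrite -[in LHS](U_K g v) U_dot. Qed.

Lemma U_rip g u v : rip (U g u) v = rip u (U g^-1%g v).
Proof. exact: adjoint_pair_rip (U_adj g) u v. Qed.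

Lemma U_ripV g u v : rip u (U g v) = rip (U g^-1%g u) v.
Proof. by rewrite ripC U_rip ripC. Qed.

Lemma U_nrm g u : nrm (U g u) = nrm u.
Proof.
apply/eqP; rewrite -(@eqrXn2 _ 2) ?nrm_ge0//.
by rewrite -!rip_nrm U_rip U_VK.
Qed.

Lemma conj_actionE g T u : conj_action U g T u = U g (T (U g^-1%g u)).
Proof. by []. Qed.

Lemma conj_action_fixedP g T :
  (conj_action U g T = T) <-> (forall u, U g (T u) = T (U g u)).
Proof.
split=> [h u|h]; first by rewrite -{2}h conj_actionE U_VK.
by apply/funext => u; rewrite conj_actionE h U_K.
Qed.

Lemma conj_action_bounded g T : bounded_op T -> bounded_op (conj_action U g T).
Proof.
move=> bT; apply: bounded_op_comp (U_bounded _).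
exact: bounded_op_comp (U_bounded _) bT.
Qed.

Variables (K : set G) (mu : {measure set (borel G) -> \bar R}).
Hypotheses (hausG : hausdorff_space G) (cK : compact K).
Hypotheses (gK : subgroup_set K) (haar : haar_measure K mu).
Hypothesis U_cont : forall xi, {within K, continuous (fun g => U g xi)}.

Local Notation KB := (K : set (borel G)).
Local Notation RI f := (Rintegral mu KB f).
Local Notation P := (op_integral mu K U).
Local Notation E := (average mu K U).

Definition fixed_vec u := forall g, K g -> U g u = u.

Lemma weak_family_U : weak_family K U 1.
Proof.
split=> [g _|g u _|u v]; first exact: U_lin.
  by rewrite mul1r U_nrm.
apply/subspace_continuousP => g Kg; apply: rip_cvg2; first exact: cvg_cst.
by have /subspace_continuousP := @U_cont v; exact.
Qed.

Lemma U_contV v : {within K, continuous (fun g => U g^-1%g v)}.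
Proof.
have [_ _ KV] := gK.
apply/subspace_continuousP => g Kg.
have /subspace_continuousP/(_ _ (KV _ Kg)) hU := @U_cont v.
suff hV : (k^-1)%g @[k --> within K (nbhs g)] --> within K (nbhs (g^-1)%g).
  exact: cvg_comp hV hU.
move=> V hV.
have hn : nbhs g [set k | K (k^-1)%g -> V (k^-1)%g].
  exact: (@invg_continuous G g [set k | K k -> V k] hV).
suff : nbhs g [set k | K k -> V (k^-1)%g] by [].
by apply: filterS hn => k /= h Kk; exact/h/KV.
Qed.

Lemma weak_family_conj T C : linear T -> (forall u, nrm (T u) <= C * nrm u) ->
  weak_family K (fun g => conj_action U g T) C.
Proof.
move=> lT TC; split=> [g _|g u _|u v].
- by move=> c u v; rewrite /conj_action /= U_lin lT U_lin.
- by rewrite conj_actionE U_nrm (le_trans (TC _))// U_nrm.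
have bT := bound_bounded_op lT TC.
have -> : (fun g => rip u (conj_action U g T v)) =
    (fun g => rip (U g^-1%g u) (T (U g^-1%g v))).
  by apply/funext => g; rewrite conj_actionE U_ripV.
apply/subspace_continuousP => g Kg; apply: rip_cvg2.
  by have /subspace_continuousP := @U_contV u; exact.
have /subspace_continuousP/(_ _ Kg) h := @U_contV v.
by apply: cvg_comp h _; have [_] := bT; exact.
Qed.

(** Together with [rip_P], this says that [P] is the orthogonal projection onto the
vectors fixed by [K]. *)
Lemma fixed_P u : fixed_vec (P u).
Proof.
move=> h Kh; apply: rip_ext => w.
have hP := op_integralP hausG cK haar weak_family_U.
rewrite U_ripV !(op_integral_rip _ _ hP).
have [_ _ cU] := weak_family_U.
have eF : (fun g => rip w (U (h * g)%g u)) = (fun g => rip (U h^-1%g w) (U g u)).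
  by apply/funext => g; rewrite U_mul U_ripV.
rewrite -eF.
apply: (@Rintegral_shift _ _ _ _ hausG cK gK haar (fun g => rip w (U g u))
  (1 * nrm w * nrm u)) => //.
  by move=> g Kg; exact: weak_family_rip_le weak_family_U Kg.
by rewrite eF.
Qed.

Lemma rip_P u v : fixed_vec u -> rip u (P v) = rip u v.
Proof.
move=> fu; have hP := op_integralP hausG cK haar weak_family_U.
rewrite (op_integral_rip _ _ hP) -[RHS](Rintegral_cst1 hausG cK haar).
apply: eq_Rintegral => g; rewrite inE => Kg.
by have [_ _ KV] := gK; rewrite U_ripV fu//; exact: KV.
Qed.

Lemma rip_P_PP u v : rip u (P v) = rip (P u) (P v).
Proof. by rewrite ripC [RHS]ripC [RHS]rip_P//; exact: fixed_P. Qed.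

Section Average.
Variable T : H -> H.
Hypothesis bT : bounded_op T.

Let bT' : exists C, weak_family K (fun g => conj_action U g T) C.
Proof.
have [C _ TC] := bounded_op_bound bT; exists C.
exact: weak_family_conj (bounded_op_lin bT) TC.
Qed.

Lemma averageP : is_op_integral mu K (fun g => conj_action U g T) (E T).
Proof. by have [C /(op_integralP hausG cK haar)] := bT'. Qed.

Lemma average_bounded : bounded_op (E T).
Proof. by have [] := averageP. Qed.

Lemma average_rip u v :
  rip u (E T v) = RI (fun g => rip (U g^-1%g u) (T (U g^-1%g v))).
Proof.
rewrite (op_integral_rip _ _ averageP); apply: eq_Rintegral => g _.
by rewrite conj_actionE U_ripV.
Qed.

Lemma average_unique S :
  (forall u v, rip u (S v) = RI (fun g => rip (U g^-1%g u) (T (U g^-1%g v)))) ->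
  E T = S.
Proof.
by move=> h; apply/funext => v; apply: rip_ext => u; rewrite h average_rip.
Qed.

Lemma average_nrm C u : (forall u, nrm (T u) <= C * nrm u) ->
  nrm (E T u) <= C * nrm u.
Proof.
move=> TC; apply: op_integral_nrm => //.
exact: weak_family_conj (bounded_op_lin bT) TC.
Qed.

Lemma conj_average h : K h -> conj_action U h (E T) = E T.
Proof.
move=> Kh; apply/funext => v; apply: rip_ext => u.
rewrite conj_actionE U_ripV !average_rip.
have [C wf] := bT'; have [_ _ cF] := wf.
have fE w z : (fun g => rip (U g^-1%g w) (T (U g^-1%g z))) =
    (fun g => rip w (conj_action U g T z)).
  by apply/funext => g; rewrite conj_actionE U_ripV.
have eF : (fun g => rip (U (h * g)^-1%g u) (T (U (h * g)^-1%g v))) =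
    (fun g => rip (U g^-1%g (U h^-1%g u)) (T (U g^-1%g (U h^-1%g v)))).
  by apply/funext => g; rewrite !invgM !U_mul.
rewrite -eF.
apply: (@Rintegral_shift _ _ _ _ hausG cK gK haar
  (fun g => rip (U g^-1%g u) (T (U g^-1%g v))) (C * nrm u * nrm v)) => //.
- by rewrite fE.
- move=> g Kg; rewrite -U_ripV.
  exact: (@weak_family_rip_le _ _ _ _ _ _ u v _ wf Kg).
- by rewrite eF fE.
Qed.

Lemma average_id : (forall g, K g -> conj_action U g T = T) -> E T = T.
Proof.
move=> fT; apply: average_unique => u v.
rewrite -[LHS](Rintegral_cst1 hausG cK haar).
apply: eq_Rintegral => g; rewrite inE => Kg.
by rewrite -U_ripV -[in LHS](fT _ Kg).
Qed.

(** For fixed [v], the integrand [U g (T (U g^-1 v))] is [U g (T v)]. *)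
Lemma average_fixed v : fixed_vec v -> E T v = P (T v).
Proof.
move=> fv; apply: rip_ext => u.
have hP := op_integralP hausG cK haar weak_family_U.
rewrite average_rip (op_integral_rip _ _ hP).
apply: eq_Rintegral => g; rewrite inE => Kg.
by have [_ _ KV] := gK; rewrite -U_ripV fv//; exact: KV.
Qed.

Lemma average_positive : positive_op T -> positive_op (E T).
Proof.
move=> pT u; rewrite dotE !average_rip lecE /=.
have h g : rip ('i%C *: U g^-1%g u) (T (U g^-1%g u)) = 0.
  by have := pT (U g^-1%g u); rewrite lecE /= -Im_dot => /andP[/eqP].
apply/andP; split.
  rewrite (@eq_Rintegral _ _ _ _ _ (fun=> 0)) ?Rintegral_cst1// => g _.
  by rewrite (linZ _ _ (U_lin g^-1%g)) h.
apply: Rintegral_ge0 => g _.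
by have := pT (U g^-1%g u); rewrite lecE => /andP[].
Qed.

End Average.

Lemma average_lincomb (c : R[i]) S T : bounded_op S -> bounded_op T ->
  E (fun u => c *: S u + T u) = (fun u => c *: E S u + E T u).
Proof.
move=> bS bT; apply: average_unique; first exact: bounded_op_lincomb.
move=> u v; rewrite ripDr ripZ !average_rip// -RintegralD.
- by apply: eq_Rintegral => g _; rewrite ripDr ripZ linZ//; exact: U_lin.
- exact: measurable_subgroup.
- have [C _ SC] := bounded_op_bound bS.
  have wf := weak_family_conj (bounded_op_lin bS) SC.
  have := weak_family_integrable hausG cK haar (conjc c *: u) v wf.
  by congr integrable; apply/funext => g; rewrite /= conj_actionE U_ripV.
- have [C _ TC] := bounded_op_bound bT.
  have wf := weak_family_conj (bounded_op_lin bT) TC.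
  have := weak_family_integrable hausG cK haar u v wf.
  by congr integrable; apply/funext => g; rewrite /= conj_actionE U_ripV.
Qed.

Lemma average_bimodule S T S' : bounded_op S -> bounded_op T -> bounded_op S' ->
  (forall g, K g -> conj_action U g S = S) ->
  (forall g, K g -> conj_action U g S' = S') ->
  E (S \o T \o S') = S \o E T \o S'.
Proof.
move=> bS bT bS' fS fS'; have [S1 bS1 aS] := adjoint_ex bS.
have ripS u v : rip u (S v) = rip (S1 u) v.
  by rewrite -(adjoint_pair_rip (adjoint_pairC aS)).
have [_ _ KV] := gK.
apply: average_unique => [|u v].
  by apply: bounded_op_comp bS'; exact: bounded_op_comp bT.
rewrite /= ripS average_rip//; apply: eq_Rintegral => g; rewrite inE => Kg.
have /conj_action_fixedP <- := fS' _ (KV _ Kg).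
by rewrite -!U_ripV; have /conj_action_fixedP -> := fS _ Kg; rewrite ripS.
Qed.

End Unitary.

(** * Least upper bounds of increasing nets of self-adjoint operators *)

Section SelfAdjoint.
Context {R : realType} {H : hilbertType R}.
Implicit Types (u v w : H) (S T : H -> H) (D : set (H -> H)).

Lemma positive_op_rip T :
  positive_op T <-> forall u, 0 <= rip u (T u) /\ rip ('i%C *: u) (T u) = 0.
Proof.
split=> h u; have := h u; rewrite ?dotE lecE /=.
  by move=> /andP[/eqP].
by move=> [-> ->]; rewrite eqxx.
Qed.

Lemma adjoint_pair_Im T u : adjoint_pair T T -> rip ('i%C *: u) (T u) = 0.
Proof.
move=> aT; rewrite -Im_dot; have : dot u (T u) = conjc (dot u (T u)).
  by rewrite -dotC aT.
by case: (dot u (T u)) => a b [] /=; lra.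
Qed.

Lemma op_le_rip S T u : op_le S T -> rip u (S u) <= rip u (T u).
Proof. by move=> /(_ u); rewrite lecE => /andP[]. Qed.

Lemma rip_op_le S T : adjoint_pair S S -> adjoint_pair T T ->
  (forall u, rip u (S u) <= rip u (T u)) -> op_le S T.
Proof.
by move=> aS aT h u; rewrite lecE !Im_dot !adjoint_pair_Im// eqxx; exact: h.
Qed.

(** Cauchy-Schwarz for the positive form of [T - S]. *)
Lemma op_le_CS S T u v : selfadjoint_op S -> selfadjoint_op T -> op_le S T ->
  rip u (T v - S v) ^+ 2 <= rip u (T u - S u) * rip v (T v - S v).
Proof.
move=> [bS aS] [bT aT] ST.
have lS := bounded_op_lin bS; have lT := bounded_op_lin bT.
apply: quad_disc => t.
have := op_le_rip (u + t%:C *: v) ST.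
rewrite (linD _ _ lS) (linD _ _ lT) (linZ _ _ lS) (linZ _ _ lT).
rewrite !ripBr !(ripDl, ripDr, ripZl, ripZr).
rewrite (ripC v (T u)) (ripC v (S u)) (adjoint_pair_rip aT) (adjoint_pair_rip aS).
by move=> h; rewrite -subr_ge0 in h; apply: le_trans h _; rewrite le_eqVlt; apply/orP; left; apply/eqP; ring.
Qed.

(** This is [op_le_CS] at [u = T v - S v].  It turns convergence of the quadratic
forms of an increasing family into norm convergence of its values. *)
Lemma op_le_nrm S T v (C : R) : selfadjoint_op S -> selfadjoint_op T ->
  op_le S T -> (forall u, rip u (T u - S u) <= C * nrm u ^+ 2) ->
  nrm (T v - S v) ^+ 2 <= C * rip v (T v - S v).
Proof.
move=> sS sT ST hC; set w := T v - S v.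
have := op_le_CS w v sS sT ST; rewrite -/w rip_nrm => h.
have q0 : 0 <= rip v w by rewrite /w ripBr subr_ge0; exact: op_le_rip.
have h2 := le_trans h (ler_wpM2r q0 (hC w)).
have := hC v; rewrite -/w => hv.
have [w0|w0] := eqVneq (nrm w) 0.
  rewrite w0 expr0n /=.
  have [v0|v0] := eqVneq (nrm v) 0.
    by rewrite (nrm_eq0 v0) rip0l mulr0.
  have vp : 0 < nrm v ^+ 2 by rewrite exprn_gt0// lt_neqAle eq_sym v0 nrm_ge0.
  by apply: mulr_ge0 => //; rewrite -(pmulr_lge0 _ vp); exact: le_trans q0 hv.
have wp : 0 < nrm w ^+ 2 by rewrite exprn_gt0// lt_neqAle eq_sym w0 nrm_ge0.
by rewrite -(ler_pM2l wp) -expr2 (le_trans h2)// mulrAC mulrC.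
Qed.

Lemma Re_norm_le (a : R[i]) : complex.Re `|a| <= `|complex.Re a| + `|complex.Im a|.
Proof.
case: a => a b; rewrite normc_def /=.
rewrite -[leRHS]ger0_norm ?addr_ge0// -sqrtr_sqr ler_wsqrtr//.
rewrite sqrrD !real_normK ?num_real// -addrA lerD2l lerDr.
by rewrite mulrn_wge0// mulr_ge0.
Qed.

Definition rank_one_sub T (c : R) v : H -> H :=
  fun u => T u - (c%:C * dot v u) *: v.

Lemma rank_one_sub_selfadjoint T c v :
  selfadjoint_op T -> selfadjoint_op (rank_one_sub T c v).
Proof.
move=> [bT aT]; split; last first.
  move=> u w; rewrite /rank_one_sub dotBl dotBr dotZl dotZr aT.
  have -> : conjc (c%:C * dot v u) = c%:C * dot u v.
    by rewrite (dotC u v); case: (dot v u) => a b /=; congr (_ +i* _); ring.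
  by rewrite mulrAC.
have [C _ hC] := bounded_op_bound bT.
have lT := bounded_op_lin bT.
pose c' := complex.Re `|c%:C|.
have c0 : 0 <= c' by rewrite -ler0c RRe_real ?ger0_real.
apply: (@bound_bounded_op _ _ _ (C + c' * ((nrm v + nrm ('i%C *: v)) * nrm v))).
  move=> d u w; rewrite /rank_one_sub lT dotDr dotZr mulrDr scalerDl opprD.
  by rewrite scalerBr scalerA mulrCA addrACA.
move=> u; rewrite /rank_one_sub (le_trans (nrmD _ _))// nrmN nrmZ normrM.
rewrite (mulrDl C) lerD//.
have -> : complex.Re (`|c%:C| * `|dot v u|) = c' * complex.Re `|dot v u|.
  by rewrite /c' !normc_def /=; ring.
rewrite -!mulrA ler_wpM2l// [leRHS]mulrCA [leLHS]mulrC ler_wpM2l ?nrm_ge0//.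
rewrite (le_trans (Re_norm_le _))// mulrDl Im_dot lerD//; exact: rip_CS.
Qed.

Definition sqnorm (z : R[i]) : R := complex.Re z ^+ 2 + complex.Im z ^+ 2.

Lemma rip_rank_one_sub T c v u :
  rip u (rank_one_sub T c v u) = rip u (T u) - c * sqnorm (dot v u).
Proof.
rewrite /rank_one_sub ripBr; congr (_ - _).
rewrite /rip dotZr (dotC u v); case: (dot v u) => a b; rewrite /sqnorm /=.
ring.
Qed.

(** The phase of [u] is adjusted so that [rip] sees the full modulus of
[dot v u]. *)
Lemma rip_phase T v u : linear T -> forall z, z = dot v u ->
  rip (conjc z *: u) v = sqnorm z /\ rip (conjc z *: u) (T (conjc z *: u)) = sqnorm z * rip u (T u).
Proof.
move=> lT z zE; rewrite (linZ _ _ lT) /rip dotZl dotZl dotZr (dotC u v) -zE conjcK.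
case: z zE (dot u (T u)) => a b _ [c d]; rewrite /sqnorm /=.
by split; ring.
Qed.

(** If the gap at [z] stayed above a positive number, the vectors [(T - d) z] would
converge along the family to some [v] with [rip z v > 0], and [T] minus a small
multiple of the projection on [v] would be a smaller upper bound. *)
Lemma op_sup_gap D T z (e : R) :
  D !=set0 -> (forall S, D S -> selfadjoint_op S) ->
  (forall S1 S2, D S1 -> D S2 -> exists S, [/\ D S, op_le S1 S & op_le S2 S]) ->
  op_sup D T -> 0 < e -> exists2 S, D S & rip z (T z) - rip z (S z) < e.
Proof.
move=> [d0 Dd0] sD dirD [sT ubT lubT] e0; apply: contrapT => nex.
pose q S := rip z (T z - S z).
have qe S : D S -> e <= q S.
  move=> DS; rewrite leNgt; apply/negP => h; apply: nex; exists S => //.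
  by rewrite -ripBr.
have [C C0 hC] : exists2 C : R, 0 <= C &
    forall S u, D S -> op_le d0 S -> rip u (T u - S u) <= C * nrm u ^+ 2.
  have [bT _] := sT; have [bd _] := sD _ Dd0.
  have [CT CT0 hT] := bounded_op_bound bT.
  have [Cd Cd0 hd] := bounded_op_bound bd.
  exists (CT + Cd); first exact: addr_ge0.
  move=> S u DS d0S; apply: (@le_trans _ _ (rip u (T u - d0 u))).
    by rewrite !ripBr lerD2l lerN2; exact: op_le_rip.
  rewrite (le_trans (ler_norm _))// (le_trans (rip_CS _ _))//.
  rewrite expr2 mulrA mulrC ler_wpM2r ?nrm_ge0// (le_trans (nrmD _ _))//.
  by rewrite nrmN mulrDl lerD.
(* [r] is the limit of the gaps; [d n] stays above [d0] so that [C] applies. *)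
pose Q := [set q S | S in D].
have hQ : has_inf Q.
  by split; [exists (q d0), d0|exists e => _ [S DS <-]; exact: qe].
pose r := inf Q.
have rle S : D S -> r <= q S by move=> DS; apply: ge_inf; [exact: hQ.2|exists S].
have r0 : 0 < r.
  apply: lt_le_trans e0 _; apply: lb_le_inf; first exact: hQ.1.
  by move=> _ [S DS <-]; exact: qe.
have qmono S1 S2 : op_le S1 S2 -> q S2 <= q S1.
  by move=> h; rewrite /q !ripBr lerD2l lerN2; exact: op_le_rip.
have ex n : exists d, [/\ D d, op_le d0 d & q d < r + n.+1%:R^-1].
  have /inf_adherent/(_ hQ)[_ [S DS <-] hS] : 0 < n.+1%:R^-1 :> R by rewrite invr_gt0.
  have [d [Dd d0d Sd]] := dirD _ _ Dd0 DS.
  by exists d; split=> //; exact: le_lt_trans (qmono _ _ Sd) hS.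
have [d hd] := choice ex.
have close S n : D S -> op_le (d n) S ->
    nrm (S z - d n z) ^+ 2 <= C * n.+1%:R^-1.
  move=> DS dS; have [Dn d0n qn] := hd n.
  have := op_le_nrm z (sD _ Dn) (sD _ DS) dS (C := C).
  move=> /(_ _)/le_trans; apply.
    move=> u; apply: le_trans (hC _ u Dn d0n).
    by rewrite !ripBr lerD2r; exact/op_le_rip/ubT.
  rewrite ler_wpM2l//; have := rle _ DS; move: qn; rewrite /q !ripBr.
  move: (n.+1%:R^-1) => a; lra.
have inv_lt (a : R) : 0 < a -> exists N, forall n, (N <= n)%N -> C * n.+1%:R^-1 < a.
  move=> a0; have C1 : 0 < C + 1 by lra.
  have /cvgrPdist_lt/(_ _ (divr_gt0 a0 C1))[N _ hN] := @cvg_harmonic R.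
  exists N => n Nn; have := hN n Nn; rewrite /= sub0r normrN.
  have ip : 0 < n.+1%:R^-1 :> R by rewrite invr_gt0.
  rewrite gtr0_norm// ltr_pdivlMr//; move: (n.+1%:R^-1) ip => b; nra.
have small (S : nat -> H -> H) : (forall n, D (S n) /\ op_le (d n) (S n)) ->
    forall a : R, 0 < a -> exists N, forall n, (N <= n)%N ->
      nrm (S n z - d n z) < a.
  move=> hS a a0; have [N hN] := inv_lt _ (exprn_gt0 2 a0).
  exists N => n Nn; have [DS dS] := hS n.
  rewrite -ltr_sqr ?nnegrE ?nrm_ge0 ?ltW//.
  exact: le_lt_trans (close _ _ DS dS) (hN _ Nn).
have [v hv] : exists v : H, (T z - d n z) @[n --> \oo] --> v.
  apply: nrm_complete => a a0.
  have [N hN] := inv_lt _ (exprn_gt0 2 (divr_gt0 a0 (ltr0n R 2))).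
  exists N => m n Nm Nn.
  have [[Dm _ _] [Dn _ _]] := (hd m, hd n).
  have [S [DS mS nS]] := dirD _ _ Dm Dn.
  have hk k : (N <= k)%N -> op_le (d k) S -> nrm (S z - d k z) < a / 2.
    move=> Nk kS; rewrite -ltr_sqr ?nnegrE ?nrm_ge0 ?divr_ge0 ?ltW//.
    exact: le_lt_trans (close _ _ DS kS) (hN _ Nk).
  have -> : T z - d m z - (T z - d n z) = (S z - d m z) - (S z - d n z).
    have sub3 (a' b c : H) : a' - b - (a' - c) = c - b.
      by rewrite opprB addrC addrA subrK.
    by rewrite !sub3.
  have := nrmD (S z - d m z) (- (S z - d n z)); rewrite nrmN.
  have := hk _ Nm mS; have := hk _ Nn nS; lra.
have rv : r <= rip z v.
  apply: (@le_seq_lim R (fun=> r) (fun n => q (d n))).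
  - exact: cvg_cst.
  - exact: rip_cvg.
  - by move=> n; apply: rle; have [] := hd n.
have below S u : D S -> rip u v ^+ 2 <= rip u (T u - S u) * r.
  move=> DS.
  have exS n : exists S', [/\ D S', op_le S S' & op_le (d n) S'].
    by have [Dn _ _] := hd n; exact: dirD.
  have [S' hS'] := choice exS.
  have cS' : (T z - S' n z) @[n --> \oo] --> v.
    apply/nrm_cvgP => a a0.
    have [|N1 hN1] := small S' _ (a / 2) (divr_gt0 a0 (ltr0n R 2)).
      by move=> n; have [] := hS' n.
    have /nrm_cvgP/(_ _ (divr_gt0 a0 (ltr0n R 2)))[N2 hN2] := hv.
    exists (maxn N1 N2) => n; rewrite geq_max => /andP[n1 n2].
    have := hN1 _ n1; have := hN2 _ n2.
    have := nrmD (T z - d n z - v) (- (S' n z - d n z)); rewrite nrmN.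
    have -> : T z - d n z - v - (S' n z - d n z) = T z - S' n z - v.
      by rewrite addrAC opprB addrA subrK.
    lra.
  apply: (@le_seq_lim R (fun n => rip u (T z - S' n z) ^+ 2)
      (fun n => rip u (T u - S u) * (r + n.+1%:R^-1))).
  - by apply: cvgM; exact: rip_cvg.
  - have -> : rip u (T u - S u) * r = rip u (T u - S u) * (r + 0) by rewrite addr0.
    apply: cvgM; first exact: cvg_cst.
    by apply: cvgD; [exact: cvg_cst|exact: cvg_harmonic].
  - move=> n; have [DS' SS' dS'] := hS' n.
    rewrite (le_trans (op_le_CS u z (sD _ DS') sT (ubT _ DS')))//.
    have [_ _ qn] := hd n.
    apply: ler_pM.
    + by rewrite ripBr subr_ge0; exact/op_le_rip/ubT.
    + exact: le_trans (ltW r0) (rle _ DS').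
    + by rewrite !ripBr lerD2l lerN2; exact: op_le_rip.
    + exact: le_trans (qmono _ _ dS') (ltW qn).
(* The smaller upper bound that contradicts the choice of [T]. *)
pose T' := rank_one_sub T r^-1 v.
have sT' : selfadjoint_op T' by exact: rank_one_sub_selfadjoint.
have ubT' S : D S -> op_le S T'.
  move=> DS; have [[bS aS] [bT aT]] := (sD _ DS, sT).
  apply: rip_op_le => //; first by case: sT'.
  move=> u; rewrite rip_rank_one_sub.
  have := below S (conjc (dot v u) *: u) DS.
  have [-> +] := rip_phase (bounded_op_lin bT) (erefl (dot v u)).
  have [_ +] := rip_phase (bounded_op_lin bS) (erefl (dot v u)).
  rewrite ripBr => -> ->.
  have n0 : 0 <= sqnorm (dot v u) by rewrite /sqnorm addr_ge0// sqr_ge0.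
  move: (sqnorm (dot v u)) n0 => n n0 h.
  have g0 : 0 <= rip u (T u) - rip u (S u).
    by rewrite subr_ge0; exact/op_le_rip/ubT.
  have : n <= (rip u (T u) - rip u (S u)) * r.
    have [->|n1] := eqVneq n 0; first by rewrite mulr_ge0// ltW.
    have np : 0 < n by rewrite lt_neqAle eq_sym n1.
    rewrite -(ler_pM2l np); by rewrite mulrA mulrBr -expr2.
  rewrite -ler_pdivrMr// (mulrC r^-1); lra.
have := op_le_rip z (lubT _ sT' ubT'); rewrite rip_rank_one_sub.
have : 0 < r^-1 * sqnorm (dot v z).
  rewrite mulr_gt0 ?invr_gt0// /sqnorm.
  have -> : complex.Re (dot v z) = rip z v by rewrite ripC.
  have : 0 < rip z v by exact: lt_le_trans rv.
  by move=> h; rewrite ltr_wpDr ?sqr_ge0// exprn_gt0.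
lra.
Qed.

(** From the gap at [z] to all matrix coefficients by [op_le_CS], as the gaps at [u]
stay below that of one member of the family. *)
Lemma op_sup_weak D T z u (e : R) :
  D !=set0 -> (forall S, D S -> selfadjoint_op S) ->
  (forall S1 S2, D S1 -> D S2 -> exists S, [/\ D S, op_le S1 S & op_le S2 S]) ->
  op_sup D T -> 0 < e -> exists2 S, D S & `|rip u (T z - S z)| < e.
Proof.
move=> D0 sD dirD supT e0; have [sT ubT _] := supT; have [d0 Dd0] := D0.
pose c := rip u (T u - d0 u).
have c0 : 0 <= c by rewrite /c ripBr subr_ge0; exact/op_le_rip/ubT.
have c1 : 0 < c + 1 by lra.
(* This gap bounds the squared coefficient by [c * (e ^+ 2 / (c + 1)) < e ^+ 2]. *)
have [S1 DS1 h1] := @op_sup_gap D T z _ D0 sD dirD supT (divr_gt0 (exprn_gt0 2 e0) c1).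
have [S [DS d0S S1S]] := dirD _ _ Dd0 DS1.
exists S => //; rewrite -ltr_sqr ?nnegrE ?normr_ge0 ?ltW// real_normK ?num_real//.
apply: le_lt_trans (op_le_CS u z (sD _ DS) sT (ubT _ DS)) _.
have hu : rip u (T u - S u) <= c.
  by rewrite /c !ripBr lerD2l lerN2; exact: op_le_rip.
have hz : rip z (T z - S z) < e ^+ 2 / (c + 1).
  by apply: le_lt_trans h1; rewrite ripBr lerD2l lerN2; exact: op_le_rip.
have z0 : 0 <= rip z (T z - S z) by rewrite ripBr subr_ge0; exact/op_le_rip/ubT.
have := ler_wpM2r z0 hu; move: hz; rewrite ltr_pdivlMr//; nra.
Qed.

End SelfAdjoint.

(** * Limits, operator norm and commutants *)

Section Limits.
Context {R : realType} {H : hilbertType R}.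
Implicit Types (u v w : H) (S T : H -> H) (B : set (H -> H)).

Lemma seq_lim_unique (u v : nat -> H) (a b : H) N :
  (forall n, (N <= n)%N -> u n = v n) ->
  u n @[n --> \oo] --> a -> v n @[n --> \oo] --> b -> a = b.
Proof.
move=> uv /nrm_cvgP ua /nrm_cvgP vb; have [//|ab] := eqVneq a b.
have d0 : 0 < nrm (a - b) / 2.
  rewrite divr_gt0// lt_neqAle nrm_ge0 andbT eq_sym.
  by apply: contra_neq ab => /nrm_eq0/eqP; rewrite subr_eq0 => /eqP.
have [N1 h1] := ua _ d0; have [N2 h2] := vb _ d0.
pose n := maxn N (maxn N1 N2).
have := h1 n (ltac:(by rewrite !leq_max leqnn orbT)).
have := h2 n (ltac:(by rewrite !leq_max leqnn !orbT)).
rewrite -uv ?leq_max ?leqnn// (nrmBC (u n) a).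
have := nrmB a (u n) b => *; exfalso; lra.
Qed.

Lemma strong_limE (T : nat -> H -> H) u :
  (exists l : H, T n u @[n --> \oo] --> l) ->
  T n u @[n --> \oo] --> strong_lim T u.
Proof. by move=> h; apply/(@cvg_ex H). Qed.

Lemma nrm_lim_le (u : nat -> H) l (C : R) :
  u n @[n --> \oo] --> l -> (forall n, nrm (u n) <= C) -> nrm l <= C.
Proof.
by move=> ul h; apply: le_seq_lim (nrm_cvg ul) (cvg_cst C) h.
Qed.

Lemma rip_lim_eq w (u : nat -> H) l (c : R) :
  u n @[n --> \oo] --> l -> (forall n, rip w (u n) = c) -> rip w l = c.
Proof.
move=> /(rip_cvg w) ul h; apply/eqP; rewrite eq_le; apply/andP; split.
  by apply: le_seq_lim ul (cvg_cst c) _ => n; rewrite h.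
by apply: le_seq_lim (cvg_cst c) ul _ => n; rewrite h.
Qed.

Lemma opnorm_le T (C : R) : linear T -> (forall u, nrm u <= 1 -> nrm (T u) <= C) ->
  opnorm T <= C.
Proof.
move=> lT h; apply: ge_sup.
  by exists (complex.Re `|T 0|), 0 => //=; rewrite normr0 ler01.
by move=> _ [u /= u1 <-]; apply: h; rewrite -lecR -normE.
Qed.

Lemma opnorm_ub T u : bounded_op T -> nrm u <= 1 -> nrm (T u) <= opnorm T.
Proof.
move=> bT u1; have [C C0 hC] := bounded_op_bound bT.
apply: ub_le_sup; last by exists u => //=; rewrite normE lecR.
exists C => _ [w /= w1 <-]; apply: le_trans (hC w) _.
by rewrite ler_piMr// -lecR -normE.
Qed.

Lemma opnorm_ge T u : bounded_op T -> nrm (T u) <= opnorm T * nrm u.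
Proof.
move=> bT; have lT := bounded_op_lin bT.
have [u0|u0] := eqVneq (nrm u) 0.
  by rewrite u0 mulr0 (nrm_eq0 u0) (lin0 lT) nrm0.
have up : 0 < nrm u by rewrite lt_neqAle eq_sym u0 nrm_ge0.
have := @opnorm_ub _ ((nrm u)^-1%:C *: u) bT.
rewrite (linZ _ _ lT) !nrmZr gtr0_norm ?invr_gt0// mulVf// => /(_ (lexx _)).
by rewrite mulrC ler_pdivrMr.
Qed.

Lemma commutant_lincomb B (c : R[i]) S T : (forall A, B A -> linear A) ->
  commutant B S -> commutant B T -> commutant B (fun u => c *: S u + T u).
Proof.
move=> lB [bS hS] [bT hT]; split; first exact: bounded_op_lincomb.
move=> A BA; apply/funext => u /=; rewrite (lB _ BA).
have /(congr1 (@^~ u)) /= -> := hS _ BA.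
by have /(congr1 (@^~ u)) /= -> := hT _ BA.
Qed.

Lemma commutant_comp B S T :
  commutant B S -> commutant B T -> commutant B (S \o T).
Proof.
move=> [bS hS] [bT hT]; split; first exact: bounded_op_comp.
by move=> A BA; rewrite compA hS// -compA hT.
Qed.

Lemma commutant_id B : commutant B idfun.
Proof. by split=> [|A _]; [exact: bounded_op_id|]. Qed.

Lemma commutantE B S A u : commutant B S -> B A -> A (S u) = S (A u).
Proof. by move=> [_ h] /h /(congr1 (@^~ u)). Qed.

End Limits.

(** * Separating vectors are cyclic for the commutant *)

Section Cyclic.
Context {R : realType} {H : hilbertType R}.
Implicit Types (u v w : H) (S T A : H -> H).
Variables (B : set (H -> H)).
Hypotheses (bB : B `<=` bounded_op).
Hypothesis (aB : forall S, B S -> exists2 T, B T & adjoint_pair S T).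

Local Notation M' := (commutant B).
Local Notation M := (commutant (commutant B)).

Lemma commutant_lin C A : @commutant R H C A -> linear A.
Proof. by move=> [/bounded_op_lin]. Qed.

(** The projection onto the closure of [M' Om] belongs to [M] and agrees with the
identity at [Om]; as [Om] is separating for [M], this projection is the identity. *)
Lemma separating_cyclic Om : (forall T, M T -> T Om = 0 -> T = 0) ->
  forall u, exists2 A : nat -> H -> H, forall n, M' (A n) &
    A n Om @[n --> \oo] --> u.
Proof.
move=> sep.
(* [W] is the closure of [M' Om], and [p] below the projection onto it. *)
pose W u := forall e : R, 0 < e -> exists2 A, M' A & nrm (u - A Om) < e.
have lB A : B A -> linear A by move=> /bB /bounded_op_lin.
have WA A u : M' A -> W u -> W (A u).
  move=> MA Wu e e0; have [bA _] := MA; have [C C0 hC] := bounded_op_bound bA.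
  have C1 : 0 < C + 1 by lra.
  have [A1 MA1 h1] := Wu _ (divr_gt0 e0 C1).
  exists (A \o A1); first exact: commutant_comp.
  rewrite /= -(linB _ _ (commutant_lin MA)).
  apply: le_lt_trans (hC _) _; move: h1; rewrite ltr_pdivlMr//.
  have := nrm_ge0 (u - A1 Om); nra.
have WD (c : R[i]) u v : W u -> W v -> W (c *: u + v).
  move=> Wu Wv e e0; have e2 : 0 < e / 2 by rewrite divr_gt0.
  pose k := complex.Re `|c|.
  have k0 : 0 <= k by rewrite -ler0c RRe_real ?ger0_real.
  have k1 : 0 < k + 1 by lra.
  have [A1 MA1 h1] := Wu _ (divr_gt0 e2 k1); have [A2 MA2 h2] := Wv _ e2.
  exists (fun w => c *: A1 w + A2 w); first exact: commutant_lincomb.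
  have -> : c *: u + v - (c *: A1 Om + A2 Om) = c *: (u - A1 Om) + (v - A2 Om).
    by rewrite scalerBr opprD addrACA.
  apply: le_lt_trans (nrmD _ _) _; rewrite nrmZ -/k.
  move: h1; rewrite ltr_pdivlMr//; have := nrm_ge0 (u - A1 Om); nra.
have WOm : W Om.
  by move=> e e0; exists idfun; [exact: commutant_id|rewrite subrr nrm0].
have W0 : W 0.
  have := WD (-1) _ _ WOm WOm; by rewrite scaleN1r addNr.
have WZ c u : W u -> W (c *: u) by move=> Wu; rewrite -[_ *: _]addr0; exact: WD.
have ex v : exists w, W w /\ forall u, W u -> rip w u = rip v u.
  have [||||||w Ww hw] := @riesz_closed _ _ W (rip v) (nrm v) W0; last by exists w.
  - by move=> u w Wu Ww; rewrite -[u]scale1r; exact: WD.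
  - by move=> t u; exact: WZ.
  - move=> u l Wu /nrm_cvgP ul e e0; have e2 : 0 < e / 2 by rewrite divr_gt0.
    have [N /(_ N (leqnn _)) hN] := ul _ e2; have [A MA hA] := Wu N _ e2.
    exists A => //; apply: le_lt_trans (nrmB _ (u N) _) _.
    rewrite (nrmBC l); lra.
  - by move=> u w; rewrite ripDr.
  - by move=> t u; rewrite ripZr.
  - by move=> u; exact: rip_CS.
have [p hp] := choice ex.
have pu w v : W w -> (forall u, W u -> rip w u = rip v u) -> p v = w.
  move=> Ww hw; have [Wp hpv] := hp v.
  have Wd : W (p v - w) by rewrite -scaleN1r addrC; exact: WD.
  apply/eqP; rewrite -subr_eq0; apply/eqP/nrm_eq0/eqP.
  by rewrite -sqrf_eq0 -rip_nrm ripBl hpv// hw// subrr.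
have lp : linear p.
  move=> c u v; apply: pu.
    by apply: WD; [exact: (hp u).1|exact: (hp v).1].
  move=> w Ww; rewrite !ripDl (hp v).2//; congr (_ + _).
  rewrite -[c]conjcK -!ripZ; exact/(hp u).2/WZ.
have bp : bounded_op p.
  apply: (@bound_bounded_op _ _ _ 1) => // u; rewrite mul1r.
  have [->|p0] := eqVneq (nrm (p u)) 0; first exact: nrm_ge0.
  have pp : 0 < nrm (p u) by rewrite lt_neqAle eq_sym p0 nrm_ge0.
  rewrite -(ler_pM2r pp) -expr2 -rip_nrm (hp u).2; last exact: (hp u).1.
  exact: le_trans (ler_norm _) (rip_CS _ _).
have Mp : M p.
  split=> // A MA; apply/funext => v /=; apply/esym/pu.
    by apply: WA => //; exact: (hp v).1.
  move=> u Wu; have [A1 MA1 aA] := commutant_adjoint aB MA.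
  rewrite !(adjoint_pair_rip aA); apply: (hp v).2; exact: WA.
have pOm : p Om = Om by exact: pu.
have MB : M (fun u => -1 *: idfun u + p u).
  apply: commutant_lincomb => //; last exact: commutant_id.
  by move=> A; exact: commutant_lin.
have p1 u : p u = u.
  have := sep _ MB; rewrite /= pOm scaleN1r addNr => /(_ erefl).
  by move=> /(congr1 (@^~ u))/= /eqP; rewrite scaleN1r addrC subr_eq0 => /eqP.
move=> u; have Wu : W u by rewrite -(p1 u); exact: (hp u).1.
have exA n : exists A, M' A /\ nrm (u - A Om) < n.+1%:R^-1.
  have n0 : 0 < n.+1%:R^-1 :> R by rewrite invr_gt0.
  by have [A MA hA] := Wu _ n0; exists A.
have [A hA] := choice exA.
exists A => [n|]; first exact: (hA n).1.
apply/nrm_cvgP => e e0.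
have /cvgrPdist_lt/(_ _ e0)[N _ hN] := @cvg_harmonic R.
exists N => n Nn; rewrite nrmBC; apply: lt_trans (hA n).2 _.
by have := hN n Nn; rewrite /= sub0r normrN gtr0_norm// invr_gt0.
Qed.

End Cyclic.

(** * Averages along an increasing sequence of compact groups *)

Section Ergodic.
Context {R : realType} {G : topGroupType} {H : hilbertType R}.
Variables (U : G -> H -> H) (GN : nat -> set G).
Variables (mu : nat -> {measure set (borel G) -> \bar R}).
Hypotheses (hausG : hausdorff_space G) (cGN : forall N, compact (GN N)).
Hypotheses (gGN : forall N, subgroup_set (GN N)).
Hypothesis (incrGN : forall M N, (M <= N)%N -> GN M `<=` GN N).
Hypothesis (haar : forall N, haar_measure (GN N) (mu N)).
Hypothesis (uU : unitary_representation U).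
Hypothesis (U_cont : forall N xi, {within GN N, continuous (fun g => U g xi)}).
Implicit Types (u v w : H) (S T A : H -> H) (m n N : nat).

Local Notation P n := (op_integral (mu n) (GN n) U).
Local Notation E n := (average (mu n) (GN n) U).

Let fixed_PN n u : fixed_vec U (GN n) (P n u).
Proof. exact: fixed_P. Qed.

Let rip_PN n u v : fixed_vec U (GN n) u -> rip u (P n v) = rip u v.
Proof. exact: rip_P. Qed.

Lemma fixed_vecS m n u : (m <= n)%N -> fixed_vec U (GN n) u -> fixed_vec U (GN m) u.
Proof. by move=> mn fu g /(incrGN mn)/fu. Qed.

Lemma P_absorb m n u : (m <= n)%N -> P n (P m u) = P n u.
Proof.
move=> mn; have hP v w : rip v (P n w) = rip (P n v) w.
  by rewrite (rip_P_PP uU hausG) // rip_PN.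
apply: rip_ext => w; rewrite !hP rip_PN//; exact: fixed_vecS mn _.
Qed.

(** Pythagoras: for [m <= n] the range of [P n] is contained in that of [P m]. *)
Lemma P_dist m n u : (m <= n)%N ->
  nrm (P m u - P n u) ^+ 2 = nrm (P m u) ^+ 2 - nrm (P n u) ^+ 2.
Proof.
move=> mn; rewrite nrm_sqrB ripC rip_PN; last exact: fixed_vecS mn _.
have <- : rip (P n u) u = nrm (P n u) ^+ 2 by rewrite -rip_nrm rip_PN.
ring.
Qed.

(** The squared norms of the [P n u] decrease, hence converge, and by [P_dist] they
control the distances. *)
Lemma P_cvg u : exists l : H, P n u @[n --> \oo] --> l.
Proof.
pose p n := nrm (P n u) ^+ 2.
have pmono m n : (m <= n)%N -> p n <= p m.
  by move=> mn; rewrite -subr_ge0 -P_dist// sqr_ge0.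
have pc : cvgn p.
  apply: nonincreasing_is_cvgn; first exact: pmono.
  by exists 0 => _ [n _ <-]; exact: sqr_ge0.
have pl n : limn p <= p n by apply: nonincreasing_cvgn_ge.
apply: nrm_complete => e e0.
have /cvgrPdist_lt/(_ _ (exprn_gt0 2 e0))[N _ hN] := pc.
suff hmn m n : (N <= m)%N -> (m <= n)%N -> nrm (P m u - P n u) < e.
  exists N => m n Nm Nn; have [mn|/ltnW nm] := leqP m n; first exact: hmn.
  by rewrite nrmBC; exact: hmn.
move=> Nm mn; rewrite -ltr_sqr ?nnegrE ?nrm_ge0 ?ltW// P_dist//.
have := hN m Nm; rewrite /= ltr_norml => /andP[h _]; have := pl n.
by rewrite /p in h *; lra.
Qed.

Local Notation PG := (strong_lim (fun n => P n)).

Lemma PG_cvg u : P n u @[n --> \oo] --> PG u.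
Proof. exact/strong_limE/P_cvg. Qed.
Arguments PG_cvg u : clear implicits.

Lemma PG_fixed n u : fixed_vec U (GN n) (PG u).
Proof.
move=> g Kg; apply: (@seq_lim_unique _ _ (fun k => U g (P k u)) (fun k => P k u) _ _ n).
- by move=> k nk; apply: (@fixed_PN k); exact: incrGN nk _ Kg.
- exact: bounded_op_cvg (U_bounded uU g) (PG_cvg u).
- exact: PG_cvg.
Qed.

Variables (B : set (H -> H)) (Om : H).
Hypotheses (bB : B `<=` bounded_op).
Hypothesis (aB : forall S, B S -> exists2 T, B T & adjoint_pair S T).
Local Notation M' := (commutant B).
Local Notation M := (commutant (commutant B)).
Hypothesis (actM : forall g T, M T -> M (conj_action U g T)).
Hypothesis (fixed_Om : forall n, fixed_vec U (GN n) Om).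
Hypothesis (sep_Om : forall T, M T -> T Om = 0 -> T = 0).

Lemma M_bounded T : M T -> bounded_op T.
Proof. by case. Qed.
Hint Resolve M_bounded : core.

Lemma M_commute A T u : M' A -> M T -> A (T u) = T (A u).
Proof. by move=> MA MT; exact: commutantE MT MA. Qed.

Lemma M_lincomb (c : R[i]) S T : M S -> M T -> M (fun u => c *: S u + T u).
Proof. by apply: commutant_lincomb => A; exact: commutant_lin. Qed.

Lemma separating_eq S T : M S -> M T -> S Om = T Om -> S = T.
Proof.
move=> MS MT ST; have := sep_Om (M_lincomb (-1) MS MT).
rewrite ST scaleN1r addNr => /(_ erefl) h; apply/funext => u.
have /(congr1 (@^~ u))/= /eqP := h.
by rewrite scaleN1r addrC subr_eq0 => /eqP.
Qed.

Section Average.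
Variable T : H -> H.
Hypothesis MT : M T.

Let bT : bounded_op T := M_bounded MT.

Lemma average_M n : M (E n T).
Proof.
split; first exact: average_bounded.
move=> A MA; apply: (@op_integral_commute _ _ _ (GN n) (mu n) (fun g => conj_action U g T)).
- exact: averageP.
- by case: MA.
- by move=> g _; have [_ h] := actM g MT; exact: h.
Qed.

Lemma average_Om n : E n T Om = P n (T Om).
Proof. exact: average_fixed. Qed.

Lemma average_fixed_algebra n : fixed_algebra M U (GN n) (E n T).
Proof. by split=> [|g Kg]; [exact: average_M|exact: conj_average]. Qed.

Lemma average_orbit n A : M' A -> E n T (A Om) = A (P n (T Om)).
Proof. by move=> MA; rewrite -average_Om (M_commute _ MA (average_M n)). Qed.

End Average.

(** Both sides lie in [M], so it suffices to compare them on the separating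
vector, where the averages act as the projections [P] and [P_absorb] applies. *)
Lemma average_absorb m n T : M T -> (m <= n)%N -> E n (E m T) = E n T.
Proof.
move=> MT mn; have ME := average_M MT m.
apply: separating_eq; [exact: average_M|exact: average_M|].
by rewrite !average_Om// P_absorb.
Qed.

(** On the dense set [M' Om] the averages of [T] act through the projections
[P n], which converge; the uniform bound extends this to every vector. *)
Lemma average_cvg T u : M T -> exists l : H, E n T u @[n --> \oo] --> l.
Proof.
move=> MT; have bT := M_bounded MT; have [C C0 hC] := bounded_op_bound bT.
have EC n v : nrm (E n T v) <= C * nrm v by exact: average_nrm.
apply: nrm_complete => e e0.
(* [C + 1] instead of [C] keeps the divisor positive. *)
have C1 : 0 < 3 * (C + 1) by rewrite mulr_gt0//; lra.
have [An MAn /nrm_cvgP cA] := separating_cyclic bB aB sep_Om u.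
have [N0 /(_ N0 (leqnn _)) hA] := cA _ (divr_gt0 e0 C1).
have {MAn} MA := MAn N0; move: (An N0) MA hA => A MA hA.
have [l hl] : exists l : H, E n T (A Om) @[n --> \oo] --> l.
  exists (A (PG (T Om))).
  have -> : (fun n => E n T (A Om)) = (fun n => A (P n (T Om))).
    by apply/funext => n; rewrite average_orbit.
  by apply: bounded_op_cvg (PG_cvg _); case: MA.
have e6 : 0 < e / 6 by rewrite divr_gt0.
have /nrm_cvgP/(_ _ e6)[N hN] := hl.
exists N => m n Nm Nn.
have d k : nrm (E k T u - E k T (A Om)) <= C * nrm (A Om - u).
  by rewrite -linB ?(nrmBC (A Om)); [exact: EC|exact/bounded_op_lin/M_bounded/average_M].
have CA : C * nrm (A Om - u) < e / 3.
  move: hA; rewrite ltr_pdivlMr//; have := nrm_ge0 (A Om - u); nra.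
have := hN m Nm; have := hN n Nn; have := d m; have := d n.
have := nrmB (E m T u) (E m T (A Om)) (E n T u).
have := nrmB (E m T (A Om)) l (E n T u).
have := nrmB l (E n T (A Om)) (E n T u).
rewrite (nrmBC l (E n T (A Om))) (nrmBC (E n T (A Om)) (E n T u)); lra.
Qed.

Local Notation Einf T := (strong_lim (fun n => E n T)).

Lemma Einf_cvg T u : M T -> E n T u @[n --> \oo] --> Einf T u.
Proof. by move=> MT; apply: strong_limE; exact: average_cvg. Qed.
Arguments Einf_cvg [T] u MT : rename.

Lemma Einf_unique T S N : M T ->
  (forall u, exists2 v : nat -> H, forall n, (N <= n)%N -> E n T u = v n &
     v n @[n --> \oo] --> S u) ->
  Einf T = S.
Proof.
move=> MT h; apply/funext => u; have [v hv vS] := h u.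
exact: seq_lim_unique hv (Einf_cvg u MT) vS.
Qed.

Lemma Einf_nrm T (C : R) u : M T -> (forall u, nrm (T u) <= C * nrm u) ->
  nrm (Einf T u) <= C * nrm u.
Proof.
move=> MT hC; apply: nrm_lim_le (Einf_cvg u MT) _ => n.
by apply: average_nrm => //; exact: M_bounded.
Qed.

Lemma Einf_lin T : M T -> linear (Einf T).
Proof.
move=> MT c u v; apply: (@seq_lim_unique _ _ (fun n => E n T (c *: u + v))
  (fun n => c *: E n T u + E n T v) _ _ 0).
- by move=> n _; rewrite (bounded_op_lin (M_bounded (average_M MT n))).
- exact: Einf_cvg.
- by apply: cvgD; [apply: cvgZr|]; exact: Einf_cvg.
Qed.

Lemma Einf_M T : M T -> M (Einf T).
Proof.
move=> MT; have [C _ hC] := bounded_op_bound (M_bounded MT).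
split.
  by apply: (@bound_bounded_op _ _ _ C); [exact: Einf_lin|move=> u; exact: Einf_nrm].
move=> A MA; apply/funext => u.
apply: (@seq_lim_unique _ _ (fun n => A (E n T u)) (fun n => E n T (A u)) _ _ 0).
- by move=> n _; rewrite (M_commute _ MA (average_M MT n)).
- by apply: bounded_op_cvg (Einf_cvg _ MT); case: MA.
- exact: Einf_cvg.
Qed.

Lemma Einf_fixed T n g : M T -> GN n g -> conj_action U g (Einf T) = Einf T.
Proof.
move=> MT Kg; apply/conj_action_fixedP => // u.
apply: (@seq_lim_unique _ _ (fun k => U g (E k T u)) (fun k => E k T (U g u)) _ _ n).
- move=> k nk; have Kkg : GN k g by exact: incrGN nk _ Kg.
  have [_ /(_ _ Kkg)] := average_fixed_algebra MT k.
  by move=> /(conj_action_fixedP uU) ->.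
- exact: bounded_op_cvg (U_bounded uU g) (Einf_cvg _ MT).
- exact: Einf_cvg.
Qed.

Lemma Einf_id T : M T -> (forall g, conj_action U g T = T) -> Einf T = T.
Proof.
move=> MT fT; apply: (@Einf_unique _ _ 0) => // u; exists (fun=> T u).
  by move=> n _; rewrite average_id//; exact: M_bounded.
exact: cvg_cst.
Qed.

Lemma Einf_lincomb (c : R[i]) S T : M S -> M T ->
  Einf (fun u => c *: S u + T u) = (fun u => c *: Einf S u + Einf T u).
Proof.
move=> MS MT; apply: (@Einf_unique _ _ 0); first exact: M_lincomb.
move=> u; exists (fun n => c *: E n S u + E n T u).
  by move=> n _; rewrite average_lincomb//; exact: M_bounded.
by apply: cvgD; [apply: cvgZr|]; exact: Einf_cvg.
Qed.

Lemma Einf_bimodule S T S' : M S -> M T -> M S' ->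
  (forall g, conj_action U g S = S) -> (forall g, conj_action U g S' = S') ->
  Einf (S \o T \o S') = S \o Einf T \o S'.
Proof.
move=> MS MT MS' fS fS'; apply: (@Einf_unique _ _ 0).
  by apply: commutant_comp => //; exact: commutant_comp.
move=> u; exists (fun n => S (E n T (S' u))).
  by move=> n _; rewrite average_bimodule//; exact: M_bounded.
by apply: bounded_op_cvg (Einf_cvg _ MT); exact: M_bounded.
Qed.

Lemma Einf_positive T : M T -> positive_op T -> positive_op (Einf T).
Proof.
move=> MT pT; apply/positive_op_rip => u.
have pE n : positive_op (E n T) by apply: average_positive => //; exact: M_bounded.
have Ec := Einf_cvg u MT.
split.
  apply: le_seq_lim (cvg_cst (0 : R)) (rip_cvg u Ec) _ => n.
  by have /positive_op_rip/(_ u)[] := pE n.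
apply: rip_lim_eq Ec _ => n.
by have /positive_op_rip/(_ u)[] := pE n.
Qed.

Lemma Einf_orbit T A : M T -> M' A -> Einf T (A Om) = A (PG (T Om)).
Proof.
move=> MT MA; apply: (@seq_lim_unique _ _ (fun n => E n T (A Om))
  (fun n => A (P n (T Om))) _ _ 0).
- by move=> n _; rewrite average_orbit.
- exact: Einf_cvg.
- by apply: bounded_op_cvg (PG_cvg _); case: MA.
Qed.

Lemma rip_PG u v : (forall n, fixed_vec U (GN n) u) -> rip u (PG v) = rip u v.
Proof.
by move=> fu; apply: rip_lim_eq (PG_cvg v) _ => n; exact: rip_PN.
Qed.

Lemma PG_adjoint u v : rip u (PG v) = rip (PG u) v.
Proof.
rewrite -(@rip_PG (PG u) v) => [|n]; last exact: PG_fixed.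
by rewrite ripC [RHS]ripC rip_PG// => n; exact: PG_fixed.
Qed.

Lemma Einf_state T : M T -> dot Om (Einf T Om) = dot Om (T Om).
Proof.
move=> MT; have -> : Einf T Om = PG (T Om).
  by rewrite (@Einf_orbit T idfun MT)//; exact: commutant_id.
apply: dot_ext; rewrite rip_PG// => n g Kg.
by rewrite (linZ _ _ (U_lin uU g)) (@fixed_Om n g Kg).
Qed.

Lemma Einf_selfadjoint T : M T -> selfadjoint_op T -> selfadjoint_op (Einf T).
Proof.
move=> MT [bT aT]; have bE := M_bounded (Einf_M MT); split=> //.
apply: adjoint_rip; first exact: bounded_op_lin.
have aE n u v : rip (E n T u) v = rip u (E n T v).
  rewrite ripC !average_rip//; apply: eq_Rintegral => g _.
  by rewrite ripC (adjoint_pair_rip aT).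
move=> u v; have cu := rip_cvg v (Einf_cvg u MT); have cv := rip_cvg u (Einf_cvg v MT).
rewrite ripC; apply/eqP; rewrite eq_le; apply/andP; split.
  by apply: le_seq_lim cu cv _ => n; rewrite ripC aE.
by apply: le_seq_lim cv cu _ => n; rewrite -aE ripC.
Qed.

Lemma Einf_le S T : M S -> M T -> op_le S T -> op_le (Einf S) (Einf T).
Proof.
move=> MS MT ST u.
have := @Einf_positive _ (M_lincomb (-1) MS MT).
rewrite Einf_lincomb// => /(_ _ u).
rewrite scaleN1r addrC dotBr subr_ge0; apply => v.
by rewrite scaleN1r addrC dotBr subr_ge0.
Qed.

(** On a vector [A Om] with [A] in [M'], the quadratic form of [Einf T] is a matrix
coefficient of [T] at [Om], which is continuous along the increasing net. *)
Lemma Einf_normal : normal_map M (fun T => Einf T).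
Proof.
move=> D T D0 DM sD dirD MT supT; have [sT ubT lubT] := supT.
have sET := Einf_selfadjoint MT sT.
split=> // [_ [S DS <-]|S sS ubS].
  by apply: Einf_le => //; [exact: DM|exact: ubT].
have [bS aS] := sS; have [bE aE] := sET.
apply: rip_op_le => // u.
have orbit A : M' A -> rip (A Om) (Einf T (A Om)) <= rip (A Om) (S (A Om)).
  move=> MA; have [A1 MA1 aA] := commutant_adjoint aB MA.
  have coef S1 : M S1 ->
      rip (A Om) (Einf S1 (A Om)) = rip (PG (A1 (A Om))) (S1 Om).
    move=> MS1; rewrite Einf_orbit// -PG_adjoint.
    by rewrite (adjoint_pair_rip (adjoint_pairC aA)).
  apply/ler_addgt0Pr => e e0.
  have [d Dd hd] := op_sup_weak Om (PG (A1 (A Om))) D0 sD dirD supT e0.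
  have := op_le_rip (A Om) (ubS _ (ex_intro2 _ _ d Dd erefl)).
  rewrite !coef//; last exact: DM.
  move: hd; rewrite ripBr ltr_norml => /andP[_]; lra.
have [A MA cA] := separating_cyclic bB aB sep_Om u.
have lim S1 : bounded_op S1 ->
    rip (A n Om) (S1 (A n Om)) @[n --> \oo] --> rip u (S1 u).
  by move=> bS1; apply: rip_cvg2 => //; exact: bounded_op_cvg.
by apply: le_seq_lim (lim _ bE) (lim _ bS) _ => n; exact: orbit.
Qed.

Hypothesis (coverGN : \bigcup_N GN N = [set: G]).

Local Notation FixG := (fixed_algebra M U [set: G]).

(** [T] is in [M] when it commutes with [M'], and fixed when it commutes with every
[U g].  The commutant of an adjoint-closed set is a von Neumann algebra. *)
Lemma fixed_algebraE : FixG = commutant (M' `|` range U).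
Proof.
apply/seteqP; split=> [T [MT fT]|T [bT hT]].
  split=> [|S [MS|[g _ <-]]]; first exact: M_bounded.
    by have [_ h] := MT; exact: h.
  by apply/funext => u /=; have /conj_action_fixedP -> := fT g I.
split=> [|g _]; first by split=> // S MS; apply: hT; left.
apply/conj_action_fixedP => // u.
by have /(congr1 (@^~ u)) := hT (U g) (or_intror (ex_intro2 _ _ g I erefl)).
Qed.

Lemma fixed_algebra_vN : von_neumann_algebra FixG.
Proof.
rewrite fixed_algebraE; split.
  move=> S; apply: commutant_adjoint => A [MA|[g _ <-]].
    by have [A1 MA1 aA] := commutant_adjoint aB MA; exists A1 => //; left.
  by exists (U g^-1%g); [right; exists g^-1%g|exact: U_adj].
by apply: commutant3 => A [[]//|[g _ <-]]; exact: U_bounded.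
Qed.

Theorem Einf_umegaki :
  umegaki_expectation M (vector_state Om) FixG (fun T => Einf T).
Proof.
split.
- by move=> T [].
- exact: fixed_algebra_vN.
- by move=> c S T MS MT; rewrite Einf_lincomb.
- move=> T MT; split=> [|g _]; first exact: Einf_M.
  have [n _ Kg] : (\bigcup_N GN N) g by rewrite coverGN.
  exact: Einf_fixed Kg.
- by move=> T [MT fT]; apply: Einf_id => // g; exact: fT.
- exact: Einf_normal.
- move=> T MT; apply: opnorm_le => [|u u1]; first exact: Einf_lin.
  have bT := M_bounded MT.
  have T0 : 0 <= opnorm T.
    by apply: le_trans (nrm_ge0 (T 0)) (opnorm_ub bT _); rewrite nrm0.
  apply: le_trans (Einf_nrm u MT (fun u => opnorm_ge u bT)) _.
  exact: ler_piMr.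
- by move=> T MT; exact: Einf_positive.
- by move=> S T S' MT [MS fS] [MS' fS']; apply: Einf_bimodule => // g; [exact: fS|exact: fS'].
- by move=> T MT; rewrite /vector_state Einf_state.
Qed.

Theorem average_martingale T : M T ->
  decreasing_martingale (fun N => fixed_algebra M U (GN N))
    (fun N => E N) (fun N => E N T).
Proof.
move=> MT; split=> [N|m n mn]; first exact: average_fixed_algebra.
exact: average_absorb.
Qed.

End Ergodic.

(** * Faithful vector states and separating vectors *)

Section Separating.
Context {R : realType} {H : hilbertType R}.
Implicit Types (u v w : H) (S T : H -> H) (B : set (H -> H)).

Lemma dense_seq (D : set H) u : dense D ->
  exists2 v : nat -> H, forall n, D (v n) & v n @[n --> \oo] --> u.
Proof.
move=> dD.
have ex n : exists v, D v /\ nrm (v - u) < n.+1%:R^-1.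
  have n0 : 0 < (n.+1%:R^-1 : R)%:C by rewrite ltcR invr_gt0.
  have [|v [vO Dv]] := dD (ball u (n.+1%:R^-1 : R)%:C)° _ (@open_interior _ _).
    by exists u; exact: nbhsx_ballx.
  exists v; split=> //; have := interior_subset vO.
  by rewrite -ball_normE /= normE ltcR nrmBC.
have [v hv] := choice ex.
exists v => [n|]; first exact: (hv n).1.
apply/nrm_cvgP => e e0.
have /cvgrPdist_lt/(_ _ e0)[N _ hN] := @cvg_harmonic R.
exists N => n Nn; apply: lt_trans (hv n).2 _.
by have := hN n Nn; rewrite /= sub0r normrN gtr0_norm// invr_gt0.
Qed.

(** If [T v = 0], faithfulness applies to the positive operator [T^* T]. *)
Lemma faithful_separating B v :
  (forall S, B S -> exists2 T, B T & adjoint_pair S T) ->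
  faithful_on (commutant B) (vector_state v) ->
  forall T, commutant B T -> T v = 0 -> T = 0.
Proof.
move=> aB fv T MT Tv0; have [T1 MT1 aT] := commutant_adjoint aB MT.
have z : T1 \o T = 0.
  apply: fv; first exact: commutant_comp.
    by move=> u; rewrite /= -aT dot_norm exprn_ge0.
  rewrite /vector_state /= Tv0 (lin0 (commutant_lin MT1)).
  by rewrite -(subrr v) dotBr subrr mul0r.
apply/funext => u; apply/nrm_eq0/eqP; rewrite -sqrf_eq0 -rip_nrm.
rewrite (adjoint_pair_rip aT).
have /(congr1 (@^~ u)) /= -> := z.
by rewrite rip0r.
Qed.

Lemma weak_cvg_rip (T : nat -> H -> H) S u v : weak_cvg T S ->
  rip u (T n v) @[n --> \oo] --> rip u (S v).
Proof.
move=> /(_ u v)/cvgrPdist_lt h; apply/cvgrPdist_lt => e e0.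
have /h[N _ hN] : 0 < e%:C by rewrite ltcR.
exists N => // n Nn /=; rewrite -ltcR; apply: le_lt_trans (hN n Nn).
rewrite /rip -raddfB; exact: normc_ge_Re.
Qed.

End Separating.

Arguments weak_cvg_rip {R H T S} u v _.

(** * The GNS representation of a quasi-invariant state *)

Section GNS.
Context {R : realType} {A : cstarAlgType R} {H : hilbertType R}.
Context {G : topGroupType}.
Variables (alpha : G -> A -> A) (phi : A -> R[i]) (s : G -> A).
Variables (pi : A -> H -> H) (Phi : H) (U : G -> H -> H).
Hypothesis (alphaG : automorphism_group alpha).
Hypothesis (gns : gns_representation phi pi Phi).
Hypothesis (uU : unitary_representation U).
Hypothesis (U_def : forall g a, U g (pi a Phi) = pi (alpha g a ** s g) Phi).
Implicit Types (u v w : H) (S T : H -> H) (g : G) (a b : A).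

Local Notation M' := (commutant (range pi)).
Local Notation M := (gns_vN pi).

Lemma pi_bounded a : bounded_op (pi a).
Proof. by have [[]] := gns. Qed.

Lemma pi_mul a b u : pi (a ** b) u = pi a (pi b u).
Proof. by have [_ -> _ _ _] := gns. Qed.

Lemma pi_star a : adjoint_pair (pi a) (pi (star a)).
Proof. by have [_ _ + _ _] := gns; apply. Qed.

Lemma range_pi_bounded : range pi `<=` bounded_op.
Proof. by move=> _ [a _ <-]; exact: pi_bounded. Qed.

Lemma range_pi_adjoint S : range pi S -> exists2 T, range pi T & adjoint_pair S T.
Proof. by move=> [a _ <-]; exists (pi (star a)); [exists (star a)|exact: pi_star]. Qed.

Lemma gns_ext S T : bounded_op S -> bounded_op T ->
  (forall a, S (pi a Phi) = T (pi a Phi)) -> forall u, S u = T u.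
Proof.
move=> bS bT ST u; have [_ _ _ _ /dense_seq] := gns.
move=> /(_ u)[v hv vu].
apply: (@seq_lim_unique _ _ (fun n => S (v n)) (fun n => T (v n)) _ _ 0).
- by move=> n _; have [a _ <-] := hv n.
- exact: bounded_op_cvg bS vu.
- exact: bounded_op_cvg bT vu.
Qed.

Lemma alphaM g a b : alpha g (a ** b) = alpha g a ** alpha g b.
Proof. by have [/(_ g)[_ -> _ _]] := alphaG. Qed.

(** The square roots in [U_def] cancel: both sides agree on the orbit [pi b Phi]. *)
Lemma U_pi g a u : U g (pi a u) = pi (alpha g a) (U g u).
Proof.
apply: (@gns_ext (U g \o pi a) (pi (alpha g a) \o U g)).
- exact: bounded_op_comp (U_bounded uU g) (pi_bounded a).
- exact: bounded_op_comp (pi_bounded _) (U_bounded uU g).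
by move=> b; rewrite /= -pi_mul !U_def alphaM !pi_mul.
Qed.

(** By [U_pi], conjugation by [U g] permutes the operators [pi a], hence it preserves
their commutant, and by the same argument their bicommutant. *)
Lemma conj_action_commutant g S : M' S -> M' (conj_action U g S).
Proof.
move=> [bS hS]; split; first exact: conj_action_bounded.
have piS a u : pi a (S u) = S (pi a u).
  by have /(congr1 (@^~ u)) := hS _ (ex_intro2 _ _ a I erefl).
have [/(_ g)[_ _ _ [beta _ alphaK]] _ _] := alphaG.
move=> _ [a _ <-]; apply/funext => u /=.
rewrite !conj_actionE -(alphaK a) -U_pi piS; congr (U g (S _)).
by rewrite -{2}(U_K uU g u) -U_pi U_VK.
Qed.

Lemma conj_action_gns g T : M T -> M (conj_action U g T).
Proof.
move=> [bT hT]; split; first exact: conj_action_bounded.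
move=> S MS; apply/funext => u; rewrite /= conj_actionE.
have := hT _ (conj_action_commutant (g^-1)%g MS).
move=> /(congr1 (@^~ (U (g^-1)%g u)))/=; rewrite !conj_actionE invgK !U_K//.
by move=> /(congr1 (U g)); rewrite U_K.
Qed.

(** With a unit in [A] this would be [U_def] at [1].  In general [pi b] kills the
difference of the two sides for every [b], by [U_pi] and [U_def], and no nonzero
vector is killed by all [pi b] since the orbit of [Phi] is dense. *)
Lemma U_Phi g : U g Phi = pi (s g) Phi.
Proof.
apply/eqP; rewrite -subr_eq0; apply/eqP; set z := _ - _.
have [/(_ g)[_ _ _ [beta _ alphaK]] _ _] := alphaG.
have piz b : pi b z = 0.
  rewrite /z (linB _ _ (bounded_op_lin (pi_bounded b))) -(alphaK b).
  by rewrite -U_pi -pi_mul U_def subrr.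
have [_ _ _ _ /dense_seq] := gns => /(_ z)[v hv vz].
apply/nrm_eq0/eqP; rewrite -sqrf_eq0 -rip_nrm; apply/eqP.
apply: rip_lim_eq vz _ => n; have [a _ <-] := hv n.
by rewrite -[a]starK -(adjoint_pair_rip (pi_star _)) piz rip0l.
Qed.

Variables (GN : nat -> set G) (mu : nat -> {measure set (borel G) -> \bar R}).
Hypotheses (hausG : hausdorff_space G) (cGN : forall N, compact (GN N)).
Hypotheses (gGN : forall N, subgroup_set (GN N)).
Hypothesis (incrGN : forall M N, (M <= N)%N -> GN M `<=` GN N).
Hypothesis (haar : forall N, haar_measure (GN N) (mu N)).
Hypothesis (U_cont : forall N xi, {within GN N, continuous (fun g => U g xi)}).

Local Notation P n := (op_integral (mu n) (GN n) U).
Local Notation K n := (op_integral (mu n) (GN n) (fun g => pi (s (g^-1)%g))).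
Local Notation PG := (strong_lim (fun n => P n)).

(** [P n Phi = K n Phi], whenever the weak integral [K n] exists: move [U g] to the
other side of the inner product and use that [P n] is self-adjoint. *)
Lemma K_Phi n T :
  is_op_integral (mu n) (GN n) (fun g => pi (s (g^-1)%g)) T -> T Phi = P n Phi.
Proof.
move=> hT; apply: rip_ext => w.
have hP := op_integralP hausG (@cGN n) (haar n) (weak_family_U uU (@U_cont n)).
have Psym u v : rip u (P n v) = rip v (P n u).
  rewrite (rip_P_PP uU hausG (@cGN n) (gGN n) (haar n) (@U_cont n)) ripC.
  by rewrite -(rip_P_PP uU hausG (@cGN n) (gGN n) (haar n) (@U_cont n)).
rewrite Psym (op_integral_rip _ _ hT) (op_integral_rip _ _ hP).
apply: eq_Rintegral => g _.
by rewrite -U_Phi U_ripV// invgK ripC.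
Qed.

(** An operator integral that does not exist is [0] by convention. *)
Lemma op_integral_neq0 n u : K n u <> 0 ->
  is_op_integral (mu n) (GN n) (fun g => pi (s (g^-1)%g)) (K n).
Proof.
move=> Kn; rewrite /op_integral; set Q := [set T | _].
have [ex|nex] := pselect (exists T, Q T); first exact: xgetPex.
by exfalso; apply: Kn; rewrite /op_integral xgetPN// => T QT; apply: nex; exists T.
Qed.

(** [K n Phi = P n Phi] for large [n], so [PG Phi = KG Phi].  As a weak limit of
elements of [M], [KG] is in [M]; if [T KG Phi = 0] then [T KG = 0] because [Phi] is
separating, and [T = 0] because [KG] is invertible. *)
Lemma weak_limit_separating (KG : H -> H) :
  faithful_on M (vector_state Phi) ->
  weak_cvg (fun n => K n) KG -> invertible_op KG ->
  forall T, M T -> T (PG Phi) = 0 -> T = 0.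
Proof.
move=> faith wK [bKG [S0 [bS0 SK KS]]] T MT TP.
have adjM' : forall S, M' S -> exists2 S1, M' S1 & adjoint_pair S S1.
  by move=> S; apply: commutant_adjoint; exact: range_pi_adjoint.
have sepPhi := faithful_separating adjM' faith.
have [[u u0]|triv] := pselect (exists u : H, u <> 0); last first.
  by apply/funext => u; apply: contrapT => h; apply: triv; exists (T u).
have KGu : KG u <> 0.
  move=> h; apply: u0; have /(congr1 (@^~ u)) /= := SK.
  by rewrite h (lin0 (bounded_op_lin bS0)).
(* [K n u] converges weakly to [KG u <> 0], so [K n u <> 0] for large [n]. *)
have [N hN] : exists N, forall n, (N <= n)%N ->
    is_op_integral (mu n) (GN n) (fun g => pi (s (g^-1)%g)) (K n).
  have d0 : 0 < rip (KG u) (KG u).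
    rewrite rip_nrm exprn_gt0// lt_neqAle nrm_ge0 andbT eq_sym.
    by apply/eqP => /nrm_eq0.
  have /cvgrPdist_lt/(_ _ d0)[N _ hN] := weak_cvg_rip (KG u) u wK.
  exists N => n Nn; apply: (@op_integral_neq0 _ u) => Kn.
  by have := hN n Nn; rewrite /= Kn rip0r subr0 gtr0_norm// ltxx.
have lim_eq (a b : R) (f g : nat -> R) : f n @[n --> \oo] --> a ->
    g n @[n --> \oo] --> b -> (forall n, (N <= n)%N -> f n = g n) -> a = b.
  move=> fa gb fg; apply/eqP; rewrite eq_le; apply/andP; split.
    by apply: ler_cvg_to fa gb _; exists N => // n Nn; rewrite /= fg.
  by apply: ler_cvg_to gb fa _; exists N => // n Nn; rewrite /= fg.
have KGPhi : KG Phi = PG Phi.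
  apply: rip_ext => w.
  have cP := @PG_cvg _ _ _ _ _ _ hausG cGN gGN incrGN haar uU U_cont Phi.
  by apply: lim_eq (weak_cvg_rip w Phi wK) (rip_cvg w cP) _ => n /hN /K_Phi ->.
have MKG : M KG.
  split=> // S MS; have [bS _] := MS; have [S1 MS1 aS] := adjM' _ MS.
  apply/funext => v; apply: rip_ext => w /=.
  rewrite -(adjoint_pair_rip (adjoint_pairC aS)).
  apply: lim_eq (weak_cvg_rip _ _ wK) (weak_cvg_rip _ _ wK) _ => n /hN hn.
  rewrite (adjoint_pair_rip (adjoint_pairC aS)).
  have := @op_integral_commute _ _ _ _ _ _ _ S hn bS.
  move=> /(_ _)/(congr1 (@^~ v))/= -> // g _.
  have [_ h] := MS; apply/esym/h; by exists (s (g^-1)%g).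
have := sepPhi _ (commutant_comp MT MKG); rewrite /= KGPhi => /(_ TP) TK0.
apply/funext => v; have /(congr1 (@^~ v)) /= <- := KS.
by have /(congr1 (@^~ (S0 v))) := TK0.
Qed.

End GNS.

(** * The limit of the averages *)

Theorem theorem4p2 (R : realType) (A : cstarAlgType R) (H : hilbertType R)
  (G : topGroupType) (alpha : G -> A -> A) (GN : nat -> set G)
  (mu : nat -> {measure set (borel G) -> \bar R})
  (phi : A -> R[i]) (x : G -> A) (pi : A -> H -> H) (Phi : H)
  (U : G -> H -> H)
  (hausdorffG : hausdorff_space G)
  (lcG : locally_compact [set: G])
  (sepG : exists2 D : set G, countable D & dense D)
  (alphaG : automorphism_group alpha)
  (GN_group : forall N, subgroup_set (GN N))
  (GN_compact : forall N, compact (GN N))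
  (GN_incr : forall M N, (M <= N)%N -> GN M `<=` GN N)
  (GN_cover : \bigcup_N GN N = [set: G])
  (haar : forall N, haar_measure (GN N) (mu N))
  (phi_state : is_state phi)
  (phi_faithful : faithful_state phi)
  (phi_sqi : strongly_quasi_invariant alpha phi x)
  (gns : gns_representation phi pi Phi)
  (U_rep : unitary_representation U)
  (U_def : forall g a,
     U g (pi a Phi) = pi (alpha g a ** cstar_sqrt (x (g^-1)%g)) Phi)
  (x_cont : forall N, {within GN N, continuous x})
  (U_cont : forall N xi, {within GN N, continuous (fun g => U g xi)}) :
  let M := gns_vN pi in
  let P := fun N => op_integral (mu N) (GN N) U in
  let PG := strong_lim P in
  let PhiG := PG Phi in
  let psiG := vector_state PhiG in
  let K := fun N => op_integral (mu N) (GN N) (fun g => pi (cstar_sqrt (x g))) in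
  let E := fun N => average (mu N) (GN N) U in
  let Einf := fun y => strong_lim (fun N => E N y) in
  (PhiG <> 0 /\ faithful_on M psiG) \/
  (* the first conjunct: phi is faithful also through its normal extension to M,
     i.e. Phi is separating for M; it is not needed in the first alternative *)
  (faithful_on M (vector_state Phi) /\
   exists KG, weak_cvg K KG /\ invertible_op KG) ->
  (forall y, M y ->
     decreasing_martingale (fun N => fixed_algebra M U (GN N)) E
       (fun N => E N y) /\
     exists2 z, M z & strong_cvg (fun N => E N y) z) /\
  umegaki_expectation M psiG (fixed_algebra M U [set: G]) Einf.
Proof.
move=> M P PG PhiG psiG K E Einf hyp.
have bB := range_pi_bounded gns.
have aB := range_pi_adjoint gns.
have sep : forall T, M T -> T PhiG = 0 -> T = 0.
  case: hyp => [[_ faith]|[faith [KG [wK iK]]]].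
    by apply: faithful_separating faith => S; exact: commutant_adjoint aB.
  (* [U_def] and [K] index the square roots by [g^-1] and by [g]. *)
  have KE N : K N = op_integral (mu N) (GN N)
      (fun g => pi (cstar_sqrt (x ((g^-1)^-1)%g))).
    by congr op_integral; apply/funext => g; rewrite invgK.
  apply: (weak_limit_separating alphaG gns U_rep U_def hausdorffG GN_compact
    GN_group GN_incr haar U_cont faith _ iK).
  by rewrite (_ : (fun n => _) = K)//; apply/funext => N; rewrite KE.
have fixG n : fixed_vec U (GN n) PhiG by exact: PG_fixed.
have actM := conj_action_gns alphaG gns U_rep U_def.
split=> [y My|]; last exact: Einf_umegaki.
split; first exact: average_martingale.
exists (Einf y) => [|u]; first exact: Einf_M.
exact: (@Einf_cvg _ _ _ _ _ _ hausdorffG GN_compact GN_group GN_incr haar U_rep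
  U_cont _ _ bB aB actM fixG sep).
Qed.
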